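(* For every $\varepsilon>0$ there is a constant $C(\varepsilon)>0$ such that for all $Q,N\in\mathbb{N}$ and every sequence $(a_n)_{n\in\mathbb{Z}[i]}$ of complex numbers, $$\sum_{\substack{q\in\mathbb{Z}[i]\setminus\{0\}\\ \mathcal{N}(q)\le Q}}\ \sum_{\substack{a\bmod q^2\\ (a,q)=1}}\Big|\sum_{\substack{n\in\mathbb{Z}[i]\\ \mathcal{N}(n)\le N}}a_n\, e\Big(\Re\Big(\frac{na}{q^2}\Big)\Big)\Big|^2\le C(\varepsilon)(QN)^{\varepsilon}\big(Q^3+Q^2\sqrt{N}+N\big)Z,$$ where $Z=\sum_{n\in\mathbb{Z}[i],\ \mathcal{N}(n)\le N}|a_n|^2$.
   Context: $e(x)=e^{2\pi i x}$. $\mathbb{Z}[i]$ denotes the Gaussian integers and $\mathcal{N}(q)=\Re(q)^2+\Im(q)^2$. ''$a\bmod q^2$, $(a,q)=1$'' means $a$ runs over a complete system of residues modulo $q^2$ in $\mathbb{Z}[i]$ with $a$ coprime to $q$. *)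

(* Defs.v *)
From HB Require Import structures.
From mathcomp Require Import all_boot all_order all_algebra.
From mathcomp Require Import all_classical all_reals.
From mathcomp Require Import exp trigo.
From mathcomp Require Import complex.
Set Implicit Arguments. Unset Strict Implicit. Unset Printing Implicit Defensive.
Import Order.TTheory GRing.Theory Num.Theory.
Local Open Scope ring_scope.
Local Open Scope complex_scope.

(* Gaussian integers Z[i], represented as pairs (Re, Im) of integers. *)
Definition gint := (int * int)%type.

Definition gadd (a b : gint) : gint := (a.1 + b.1, a.2 + b.2).
Definition gsub (a b : gint) : gint := (a.1 - b.1, a.2 - b.2).
Definition gmul (a b : gint) : gint :=
  (a.1 * b.1 - a.2 * b.2, a.1 * b.2 + a.2 * b.1).

Definition gnorm (a : gint) : int := a.1 ^+ 2 + a.2 ^+ 2.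

Definition gdvd (d m : gint) : Prop := exists k : gint, m = gmul d k.
Definition gunit (u : gint) : Prop := gdvd u (1, 0).
Definition gcoprime (a q : gint) : Prop :=
  forall d : gint, gdvd d a -> gdvd d q -> gunit d.

Definition gcong (a b m : gint) : Prop := gdvd m (gsub a b).

Definition complete_residue_system (S : seq gint) (m : gint) : Prop :=
  (forall b : gint, exists2 a, a \in S & gcong a b m) /\
  (forall i j : nat, (i < size S)%N -> (j < size S)%N ->
     gcong (nth (0, 0) S i) (nth (0, 0) S j) m -> i = j).

Definition irange (K : nat) : seq int :=
  [seq (i%:Z - K%:Z) | i <- iota 0 (K.*2.+1)].
Definition gball (K : nat) : seq gint :=
  [seq n <- [seq (x, y) | x <- irange K, y <- irange K] | gnorm n <= K%:Z].

Definition gC (R : realType) (a : gint) : R[i] := (a.1%:~R +i* a.2%:~R).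

Definition ee (R : realType) (x : R) : R[i] :=
  (cos (2 * pi * x) +i* sin (2 * pi * x)).

Definition csqnorm (R : realType) (z : R[i]) : R := (complex.Re z) ^+ 2 + (complex.Im z) ^+ 2.

Definition expsum (R : realType) (N : nat) (c : gint -> R[i]) (q a : gint) : R[i] :=
  \sum_(n <- gball N)
     c n * ee (complex.Re (gC R n * gC R a / (gC R q * gC R q))).

(* Main.v *)
Require Import Defs.
From HB Require Import structures.
From mathcomp Require Import all_boot all_order all_algebra.
From mathcomp Require Import all_classical all_reals.
From mathcomp Require Import exp trigo.
From mathcomp Require Import complex.
From mathcomp Require Import zify ring lra.
(* Imported again because MathComp has its own [gnorm], which would shadow the one of [Defs]. *)
Require Import Defs.
Import Order.TTheory GRing.Theory Num.Theory.
Local Open Scope ring_scope.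

(* By duality and positivity of the Fejer kernel, the double sum is at most
   O(K N Z), where K bounds the number of fractions a/q^2 (modulo Z[i]) in a disc
   of radius N^(-1/2) around any beta. To bound K, Dirichlet's theorem in Z[i]
   gives b/r close to beta with N(r) = O(sqrt N), and a fraction a/q^2 near beta is
   classified by the defect m = a r - b q^2, which lies in a small disc.
   Defect 0 forces q | r. For a given m <> 0, two admissible q, q0 satisfy
   r | (q - q0)(q + q0) and one factor is small, so splitting r = d e with
   d | q - q0 and e | q + q0 puts q in a residue class modulo lcm(d, e) = r/g,
   g = gcd(d, e), inside a disc; since g | 2 q0 and g^2 | r, also g^2 | 4 m,
   and this compensates the loss of the factor N(g) when summing over m.
   The remaining loss is the number of divisors of r, which is O(N(r)^eps). *)

Set Implicit Arguments.
Unset Strict Implicit.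

(** * Arithmetic of Z[i] *)

(** N times K = N^eps (1 + Q^2/sqrt N + Q^3/N) gives the three terms of the bound: 1 comes from
    defect 0, Q^2/sqrt N from the number of nonzero defects, Q^3/N from the spread of q for a given
    defect. Put D = max(|beta - b/r|^2, 1/N). A defect has norm O(N(r) Q^2 D), while the smaller of
    N(q - q0) and N(q + q0) is O(Q/(N D)), so a class modulo r holds O(1 + Q/(N D N(r))) values of
    q; in the product of the two bounds D and N(r) cancel. Only the first bound dictates the size of
    r: Dirichlet's theorem with parameter H gives N(r) D = O(max(1/H^2, H^2/N)), balanced at H =
    N^(1/4). The obstacle is that r may share factors with 2 q0, so that q^2 = q0^2 mod r can have
    many solutions; this is what the gcd g measures. *)

(* An alias of [gint]: on pairs themselves MathComp infers the componentwise product. *)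
Definition zi : Type := gint.
Bind Scope ring_scope with zi.
HB.instance Definition _ := GRing.Zmodule.copy zi gint.

Lemma zi_eq (a b : zi) : a.1 = b.1 -> a.2 = b.2 -> a = b.
Proof. by case: a b => [a1 a2] [b1 b2] /= -> ->. Qed.

Lemma gmulA : associative (gmul : zi -> zi -> zi).
Proof. by move=> a b c; apply: zi_eq; rewrite /=; ring. Qed.
Lemma gmulC : commutative (gmul : zi -> zi -> zi).
Proof. by move=> a b; apply: zi_eq; rewrite /=; ring. Qed.
Lemma gmul1 : left_id ((1, 0) : zi) (gmul : zi -> zi -> zi).
Proof. by move=> a; apply: zi_eq; rewrite /=; ring. Qed.
Lemma gmulD : left_distributive (gmul : zi -> zi -> zi) +%R.
Proof. by move=> a b c; apply: zi_eq; rewrite /=; ring. Qed.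
Lemma gone_neq0 : ((1, 0) : zi) != 0.
Proof. by []. Qed.
HB.instance Definition _ :=
  GRing.Zmodule_isComNzRing.Build zi gmulA gmulC gmul1 gmulD gone_neq0.

Definition gn (a : zi) : nat := `|gnorm a|%N.

Lemma gn_abs (a : zi) : gn a = (`|a.1| ^ 2 + `|a.2| ^ 2)%N.
Proof.
rewrite /gn /gnorm !expr2; apply/eqP; rewrite -eqz_nat gez0_abs; first by lia.
by rewrite addr_ge0 // -expr2 sqr_ge0.
Qed.

Lemma gnorm_ge0 (a : zi) : 0 <= gnorm a.
Proof. by rewrite /gnorm addr_ge0 ?sqr_ge0. Qed.

Lemma gnE (a : zi) : (gn a)%:Z = gnorm a.
Proof. by rewrite /gn gez0_abs // gnorm_ge0. Qed.

Lemma gnormM (a b : zi) : gnorm (a * b) = gnorm a * gnorm b.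
Proof. by rewrite /gnorm /=; ring. Qed.

Lemma gnM (a b : zi) : gn (a * b) = (gn a * gn b)%N.
Proof. by apply/eqP; rewrite -(eqr_nat int) natrM !natz !gnE gnormM. Qed.

Lemma gn_eq0 (a : zi) : (gn a == 0%N) = (a == 0).
Proof.
rewrite /gn absz_eq0 /gnorm paddr_eq0 ?sqr_ge0 // !sqrf_eq0.
by case: a.
Qed.

Lemma gn_gt0 (a : zi) : (0 < gn a)%N = (a != 0).
Proof. by rewrite lt0n gn_eq0. Qed.

Lemma zi_mulf_eq0 (a b : zi) : (a * b == 0) = (a == 0) || (b == 0).
Proof. by rewrite -!gn_eq0 gnM muln_eq0. Qed.

Lemma zi_mulfI (a : zi) : a != 0 -> injective (fun b : zi => a * b).
Proof.
move=> a0 b c /eqP; rewrite -subr_eq0 -mulrBr zi_mulf_eq0 (negbTE a0) /=.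
by rewrite subr_eq0 => /eqP.
Qed.

Definition zdvd (d m : zi) : Prop := exists k : zi, m = d * k.

Lemma zdvd_trans (a b c : zi) : zdvd a b -> zdvd b c -> zdvd a c.
Proof. by move=> [k ->] [l ->]; exists (k * l : zi); rewrite mulrA. Qed.
Lemma zdvd_refl (a : zi) : zdvd a a.
Proof. by exists (1 : zi); rewrite mulr1. Qed.
Lemma zdvd_mulr (a b c : zi) : zdvd a b -> zdvd a (b * c).
Proof. by move=> [k ->]; exists (k * c : zi); rewrite mulrA. Qed.
Lemma zdvd_mull (a b c : zi) : zdvd a b -> zdvd a (c * b).
Proof. by rewrite mulrC; exact: zdvd_mulr. Qed.
Lemma zdvdD (a b c : zi) : zdvd a b -> zdvd a c -> zdvd a (b + c).
Proof. by move=> [k ->] [l ->]; exists (k + l : zi); rewrite mulrDr. Qed.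
Lemma zdvdN (a b : zi) : zdvd a b -> zdvd a (- b).
Proof. by move=> [k ->]; exists (- k : zi); rewrite mulrN. Qed.
Lemma zdvdB (a b c : zi) : zdvd a b -> zdvd a c -> zdvd a (b - c).
Proof. by move=> ab ac; apply: zdvdD => //; apply: zdvdN. Qed.
Lemma zdvd_le (a b : zi) : b != 0 -> zdvd a b -> (gn a <= gn b)%N.
Proof.
move=> b0 [k bE]; move: b0; rewrite bE -gn_gt0 gnM muln_gt0 => /andP[_ k0].
exact: leq_pmulr.
Qed.

(** Rounding x/n to the nearest integer is the floor of (2x + n)/(2n). *)
Lemma round_div (x : int) (n : nat) : (0 < n)%N ->
  exists k e : int, x = n%:Z * k + e /\ (2 * e) ^+ 2 <= n%:Z ^+ 2.
Proof.
move=> n0; pose y := 2 * x + n%:Z; pose m := (2 * n)%N%:Z.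
have m0 : m != 0 by rewrite /m; lia.
have yE := divz_eq y m; have r0 := modz_ge0 y m0.
have rm : (y %% m)%Z < m by apply: ltz_pmod; rewrite /m; lia.
exists (y %/ m)%Z, (x - n%:Z * (y %/ m)%Z); split; first by rewrite subrKC.
move: yE r0 rm; rewrite /y /m; move: (divz _ _) (modz _ _) => k r yE r0 rm.
have -> : 2 * (x - n%:Z * k) = r - n%:Z by lia.
by nia.
Qed.

Lemma zi_edivn (a b : zi) : b != 0 -> exists q : zi, (gn (a - b * q) < gn b)%N.
Proof.
move=> b0; have n0 : (0 < gn b)%N by rewrite gn_gt0.
(* [c] is the conjugate of [b]. Rounding both coordinates of ac/N(b) leaves (a - bq)c with
   coordinates at most N(b)/2 in absolute value, hence of norm at most N(b)^2/2. *)
pose c : zi := (b.1, - b.2).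
have gnc : gn c = gn b by rewrite /gn /gnorm /= sqrrN.
have [k1 [e1 [E1 L1]]] := round_div (a * c : zi).1 n0.
have [k2 [e2 [E2 L2]]] := round_div (a * c : zi).2 n0.
pose q : zi := (k1, k2); exists q.
have bc : b * c = (((gn b)%:Z, 0) : zi).
  by apply: zi_eq; rewrite /= ?gnE /gnorm; ring.
have E : (a - b * q) * c = ((e1, e2) : zi).
  rewrite mulrBl mulrAC bc; apply: zi_eq.
    by rewrite -[LHS]/((a * c : zi).1 - ((gn b)%:Z * k1 - 0 * k2)) E1; ring.
  by rewrite -[LHS]/((a * c : zi).2 - ((gn b)%:Z * k2 + 0 * k1)) E2; ring.
have : (gn (a - b * q) * gn b < gn b * gn b)%N.
  rewrite -{1}gnc -gnM E -(ltr_nat int) natrM !natz {1}gnE /gnorm /=.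
  have : 0 < (gn b)%:Z ^+ 2 by rewrite exprn_gt0.
  by move: L1 L2; move: (gn b)%:Z => n; rewrite !exprMn -!expr2; lia.
by rewrite ltn_mul2r => /andP[].
Qed.

Lemma zi_bezout (a b : zi) : exists g u v s t : zi,
  [/\ g = u * a + v * b, a = g * s & b = g * t].
Proof.
have [n] := ubnP (gn b); elim: n a b => // n IH a b; rewrite ltnS => bn.
have [->|b0] := eqVneq b 0.
  by exists a, 1, 0, 1, 0; rewrite !mulr1 !mulr0 mul1r addr0.
have [q qb] := zi_edivn a b0.
have [g [u [v [s [t [gE bE rE]]]]]] := IH b (a - b * q) (leq_trans qb bn).
exists g, v, (u - v * q), (s * q + t), s; split => //; first by rewrite gE; ring.
by rewrite mulrDr -rE mulrA -bE; ring.
Qed.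

(** The Bezout form of coprimality makes Gauss's lemma and stability under squaring direct
    computations. *)
Definition zi_cop (a b : zi) := exists u v : zi, u * a + v * b = 1.

Lemma zi_gcd (a b : zi) : b != 0 -> exists g s t : zi,
  [/\ a = g * s, b = g * t, g != 0 & zi_cop s t].
Proof.
move=> b0; have [g [u [v [s [t [gE aE bE]]]]]] := zi_bezout a b.
have g0 : g != 0 by apply: contraNneq b0 => g0; rewrite bE g0 mul0r.
exists g, s, t; split => //; exists u, v; apply: (zi_mulfI g0) => /=.
by rewrite mulr1 mulrDr !(mulrCA g) -aE -bE -gE.
Qed.

Lemma gauss_dvd (a b c : zi) : zi_cop a b -> zdvd a (b * c) -> zdvd a c.
Proof.
move=> [u [v uv]] [k bc].
have -> : c = a * (u * c + v * k).
  by rewrite -{1}[c]mul1r -uv mulrDl -[v * b * c]mulrA bc; ring.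
exact: zdvd_mulr (zdvd_refl a).
Qed.

Lemma zi_copC (a b : zi) : zi_cop a b -> zi_cop b a.
Proof. by move=> [u [v E]]; exists v, u; rewrite addrC. Qed.

Lemma zi_cop_sq (a b : zi) : zi_cop a b -> zi_cop a (b * b).
Proof.
move=> [u [v uv]]; exists (u * u * a + u * v * b + u * v * b), (v * v).
have -> : 1 = (u * a + v * b) * (u * a + v * b) :> zi by rewrite uv mulr1.
by ring.
Qed.

Lemma gn1_unit (u : zi) : gn u = 1%N -> exists w : zi, u * w = 1.
Proof.
move=> u1; exists (u.1, - u.2); apply: zi_eq; rewrite /=; last by ring.
by rewrite -[1%R in RHS]/(1%N%:Z) -u1 gnE /gnorm; ring.
Qed.

Lemma gcoprime_cop (a q : zi) : gcoprime a q -> zi_cop a q.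
Proof.
move=> cop; have [g [u [v [s [t [gE aE qE]]]]]] := zi_bezout a q.
have [||w] := cop g; first by exists s.
  by exists t.
move=> E; have wE : g * (w : zi) = 1 by exact: esym E.
by exists ((w : zi) * u), ((w : zi) * v); rewrite -[RHS]wE gE; ring.
Qed.

(** * Primes of Z[i] *)

Definition zi_prime (p : zi) := (1 < gn p)%N /\
  forall x y : zi, zdvd p (x * y) -> zdvd p x \/ zdvd p y.

(** Descend until no divisor has norm strictly between 1 and N(r). Such an [r] is prime: its gcd
    with [x] is a unit, and then r | y, or has norm N(r), and then r | x. *)
Lemma zi_prime_dvd (r : zi) : (1 < gn r)%N -> exists2 p, zi_prime p & zdvd p r.
Proof.
have [n] := ubnP (gn r); elim: n r => // n IH r; rewrite ltnS => rn r1.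
have [[d [dr [d1 ltd]]]|irr] := pselect (exists d : zi, zdvd d r /\ (1 < gn d)%N /\ (gn d < gn r)%N).
  have [p pp pd] := IH d (leq_trans ltd rn) d1.
  by exists p => //; apply: zdvd_trans dr.
exists r; last exact: zdvd_refl.
split=> // x y rxy; have r0 : r != 0 by rewrite -gn_gt0 ltnW.
have [g [s [t [xE rE g0 st]]]] := zi_gcd x r0.
have [g1|g1] := leqP (gn g) 1.
  right; have /gn1_unit[w gw] : gn g = 1%N.
    by apply/eqP; rewrite eqn_leq g1 gn_gt0 g0.
  have : zdvd r (x * (w * y)) by rewrite mulrCA; apply: zdvd_mull.
  have -> : x * (w * y) = s * y by rewrite xE -[RHS]mul1r -gw; ring.
  rewrite rE => -[k kE].
  have : zdvd t (s * y) by exists (g * k : zi); rewrite kE; ring.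
  move=> /(gauss_dvd (zi_copC st)) [l ->].
  by exists (w * l : zi); rewrite -[LHS]mul1r -gw; ring.
left; have [gr|rg] := ltnP (gn g) (gn r).
  by case: irr; exists g; split => //; exists t.
have /gn1_unit[w tw] : gn t = 1%N.
  have := rg; rewrite rE gnM -{2}[gn g]muln1 leq_pmul2l ?gn_gt0 // => t1.
  apply/eqP; rewrite eqn_leq t1 gn_gt0; apply: contraNneq r0 => t0.
  by rewrite rE t0 mulr0.
exists (w * s : zi); rewrite xE {1}rE -[LHS]mul1r -tw; ring.
Qed.

(** * Lattice points in discs *)

Lemma irange_mem (K : nat) (x : int) : (x \in irange K) = (`|x|%N <= K)%N.
Proof.
apply/mapP/idP => [[i + ->]|xK]; first by rewrite mem_iota; lia.
by exists `|(x + K%:Z)%R|%N; rewrite ?mem_iota; lia.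
Qed.

Lemma irange_uniq (K : nat) : uniq (irange K).
Proof. by rewrite map_inj_uniq ?iota_uniq // => i j; lia. Qed.

Lemma ipairs_mem (K : nat) (x : gint) :
  (x \in [seq (x, y) | x <- irange K, y <- irange K]) = (`|x.1| <= K)%N && (`|x.2| <= K)%N.
Proof.
case: x => x1 x2; apply/allpairsP/andP => [[[y1 y2] [+ + [-> ->]]]|[x1K x2K]].
  by rewrite !irange_mem.
by exists (x1, x2); rewrite !irange_mem.
Qed.

(** The enclosing box loses nothing: a coordinate n contributes n^2 >= |n| to the norm. *)
Lemma gball_mem (K : nat) (x : zi) : (x \in gball K) = (gn x <= K)%N.
Proof.
rewrite mem_filter -gnE lez_nat; case: leqP => // xK; rewrite andTb.
have xE := gn_abs x; rewrite [LHS](ipairs_mem K x).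
by apply/andP; split; nia.
Qed.

Lemma gball_uniq (K : nat) : uniq (gball K).
Proof.
apply/filter_uniq/allpairs_uniq; rewrite ?irange_uniq //.
by move=> [? ?] [? ?].
Qed.

Lemma gball_sqrt (K k : nat) : (k ^ 2 <= K < k.+1 ^ 2 ->
  size (gball K) <= k.*2.+1 ^ 2)%N.
Proof.
move=> kK; have -> : (k.*2.+1 ^ 2 = size [seq (x, y) | x <- irange k, y <- irange k])%N.
  by rewrite size_allpairs size_map size_iota.
apply: uniq_leq_size; first exact: gball_uniq.
move=> x; rewrite gball_mem => xK.
have xE := gn_abs x; apply: etrans (ipairs_mem k x) _.
by apply/andP; split; nia.
Qed.

Lemma isqrt (K : nat) : exists k, (k ^ 2 <= K < k.+1 ^ 2)%N.
Proof.
elim: K => [|K [k /andP[k1 k2]]]; first by exists 0%N.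
have [l|g] := ltnP K.+1 (k.+1 ^ 2); first by exists k; rewrite l; lia.
by exists k.+1; rewrite g /=; lia.
Qed.

(** The integer square root k of [K] is at least 1, so (2k + 1)^2 <= 9 k^2 <= 9K. *)
Lemma gball_size (K : nat) : (0 < K -> size (gball K) <= 9 * K)%N.
Proof.
move=> K0; have [k kK] := isqrt K; apply: leq_trans (gball_sqrt kK) _.
have : (0 < k)%N by case: (k) kK; lia.
move: kK; rewrite -muln2; nia.
Qed.

(** * The divisor bound *)

Definition gdivs (r : zi) : seq zi := [seq d <- gball (gn r) | `[< zdvd d r >]].

Lemma gdivs_uniq r : uniq (gdivs r).
Proof. exact/filter_uniq/gball_uniq. Qed.

Lemma gdivsP (r d : zi) : r != 0 -> reflect (zdvd d r) (d \in gdivs r).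
Proof.
move=> r0; rewrite mem_filter gball_mem; apply: (iffP andP) => [[/asboolP]//|dr].
by split; [exact/asboolP | exact: zdvd_le].
Qed.

(** A divisor of pt is p times a divisor of [t], or is not divisible by [p]. Keeping [s] apart from
    [t] serves both a single factor (s = t) and one more factor in a power of [p]. *)
Lemma gdivs_mul (p s t : zi) : zi_prime p -> s != 0 -> zdvd s t -> t != 0 ->
  (forall d : zi, zdvd d (p * t) -> ~ zdvd p d -> zdvd d s) ->
  (size (gdivs (p * t)) <= size (gdivs t) + size (gdivs s))%N.
Proof.
move=> [p1 pp] s0 st t0 H; have p0 : p != 0 by rewrite -gn_gt0 ltnW.
have -> : (size (gdivs t) + size (gdivs s) =
  size ([seq (p * d)%R | d <- gdivs t] ++ gdivs s))%N by rewrite size_cat size_map.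
apply: uniq_leq_size; first exact: gdivs_uniq.
move=> d /gdivsP; rewrite zi_mulf_eq0 negb_or p0 t0 => /(_ isT) dpt.
rewrite mem_cat; have [[e dE]|pd] := pselect (zdvd p d); last first.
  by apply/orP; right; apply/gdivsP => //; apply: H.
apply/orP; left; apply/mapP; exists e; last exact: dE.
apply/gdivsP => //; case: dpt => k kE; exists k.
by apply: (zi_mulfI p0) => /=; rewrite kE dE mulrA.
Qed.

Lemma gdivs_prime_mul (p s : zi) : zi_prime p -> s != 0 ->
  (size (gdivs (p * s)) <= 2 * size (gdivs s))%N.
Proof.
move=> pp s0; rewrite mul2n -addnn; apply: gdivs_mul => //; first exact: zdvd_refl.
move=> d [e E] pd; have p0 : p != 0 by rewrite -gn_gt0 ltnW ?pp.1.
have /pp.2[//|[f fE]] : zdvd p (d * e) by exists s.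
exists f; apply: (zi_mulfI p0) => /=.
by rewrite E fE mulrCA.
Qed.

(** Each further factor [p] adds only divisors not divisible by [p], and these divide [s]: the count
    grows linearly in [k] instead of doubling. *)
Lemma gdivs_prime_exp (p s : zi) k : zi_prime p -> s != 0 ->
  (size (gdivs (p ^+ k * s)) <= k.+1 * size (gdivs s))%N.
Proof.
move=> pp s0; have p0 : p != 0 by rewrite -gn_gt0 ltnW ?pp.1.
have pk0 j : p ^+ j != 0.
  by elim: j => [|j IH]; rewrite ?expr0 ?oner_neq0 // exprS zi_mulf_eq0 negb_or p0.
elim: k => [|k IH]; first by rewrite expr0 mul1r mul1n.
rewrite exprS -mulrA; rewrite mulSn addnC.
apply: leq_trans (gdivs_mul pp s0 _ _ _) _; last by rewrite leq_add2r.
- exact/zdvd_mull/zdvd_refl.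
- by rewrite zi_mulf_eq0 negb_or pk0.
move=> d; rewrite mulrA -exprS; move: k.+1 => {IH} {}k dp pd.
elim: k dp => [|k IH]; first by rewrite expr0 mul1r.
rewrite exprS -mulrA => -[e E]; apply: IH.
have /pp.2[//|[f fE]] : zdvd p (d * e) by exists (p ^+ k * s).
exists f; apply: (zi_mulfI p0) => /=.
by rewrite E fE mulrCA.
Qed.

(** A prime factor at most doubles the number of divisors, and N(p)^eps >= P^eps >= 2 pays for it.
    The 9 bounds the number of units. *)
Lemma gdivs_rough (R : realType) (eps : R) (P : nat) : 0 <= eps ->
  2 <= P%:R `^ eps -> forall r : zi, r != 0 ->
  (forall p, zi_prime p -> zdvd p r -> (P <= gn p)%N) ->
  (size (gdivs r))%:R <= 9 * (gn r)%:R `^ eps.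
Proof.
move=> eps0 hP r; have [n] := ubnP (gn r); elim: n r => // n IH r.
rewrite ltnS => rn r0 rough; have [r1|r1] := leqP (gn r) 1.
  have -> : gn r = 1%N by apply/eqP; rewrite eqn_leq r1 gn_gt0.
  rewrite powR1 mulr1 (ler_nat R _ 9) (leq_trans _ (@gball_size 1 _)) //.
  apply: uniq_leq_size (gdivs_uniq r) _ => d.
  by rewrite mem_filter !gball_mem => /andP[_ /leq_trans]; apply.
have [p pp [s rE]] := zi_prime_dvd r1.
have s0 : s != 0 by apply: contraNneq r0 => s0; rewrite rE s0 mulr0.
have pP : (P <= gn p)%N by apply: rough => //; exists s.
have /IH/(_ s0) : (gn s < n)%N.
  apply: leq_trans rn; rewrite rE gnM ltn_Pmull ?gn_gt0 //; exact: pp.1.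
rewrite rE gnM natrM powRM // mulrCA => IHs.
apply: (@le_trans _ _ (2 * (size (gdivs s))%:R)).
  by rewrite -natrM ler_nat gdivs_prime_mul.
apply: ler_pM => //; last first.
  apply: IHs => q qp [t sE]; apply: rough => //; exists (p * t).
  by rewrite rE sE mulrCA.
by apply: (le_trans hP); apply: ge0_ler_powR; rewrite ?nnegrE ?ler_nat.
Qed.

Lemma zi_prime_factor (p r : zi) : zi_prime p -> r != 0 ->
  exists k t, r = p ^+ k * t /\ ~ zdvd p t.
Proof.
move=> pp; have [n] := ubnP (gn r); elim: n r => // n IH r.
rewrite ltnS => rn r0; have [[s rE]|npr] := pselect (zdvd p r); last first.
  by exists 0%N, r; rewrite expr0 mul1r.
have s0 : s != 0 by apply: contraNneq r0 => s0; rewrite rE s0 mulr0.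
have [|k [t [sE npt]]] := IH s _ s0.
  apply: leq_trans rn; rewrite rE gnM ltn_Pmull ?gn_gt0 //; exact: pp.1.
by exists k.+1, t; rewrite rE sE exprS mulrA.
Qed.

Lemma gnX (p : zi) k : gn (p ^+ k) = (gn p ^ k)%N.
Proof. by elim: k => // k IH; rewrite exprS gnM IH expnS. Qed.

Lemma powR_natX (R : realType) (x : R) (m k : nat) :
  (m ^ k)%:R `^ x = (m%:R `^ x) ^+ k.
Proof.
elim: k => [|k IH]; first by rewrite expn0 expr0 powR1.
by rewrite expnS natrM powRM // IH exprS.
Qed.

Lemma bernoulli_ineq (R : realType) (x : R) (k : nat) : 0 <= x ->
  1 + k%:R * x <= (1 + x) ^+ k.
Proof.
move=> x0; elim: k => [|k IH]; first by rewrite mul0r addr0 expr0.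
rewrite exprS -natr1; have : 0 <= k%:R * x * x by rewrite !mulr_ge0.
have : (1 + x) * (1 + k%:R * x) <= (1 + x) * (1 + x) ^+ k.
  by rewrite ler_wpM2l // addr_ge0.
lra.
Qed.

(* [L] contains the primes of norm below [P]; removing the powers of one of them from [r]
   costs a factor [C]. *)
Lemma gdivs_small (R : realType) (eps : R) (P : nat) (C : R) : 0 <= eps ->
  2 <= P%:R `^ eps -> 1 <= C -> (forall k, k.+1%:R <= C * (2 `^ eps) ^+ k) ->
  forall (L : seq zi) (r : zi), r != 0 ->
  (forall p, zi_prime p -> zdvd p r -> (P <= gn p)%N \/ p \in L) ->
  (size (gdivs r))%:R <= 9 * C ^+ size L * (gn r)%:R `^ eps.
Proof.
move=> eps0 hP C1 hC; elim => [|p L IH] r r0 small.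
  rewrite expr0 mulr1; apply: (gdivs_rough eps0 hP) => // p pp pr.
  by have [] := small p pp pr.
have C0 : 0 <= C by apply: le_trans C1.
have [pp|npp] := pselect (zi_prime p); last first.
  apply: (@le_trans _ _ (9 * C ^+ size L * (gn r)%:R `^ eps)).
    apply: IH => // q qp qr; have [|] := small q qp qr; first by left.
    by rewrite inE => /predU1P[qE|]; [case: npp; rewrite -qE | right].
  rewrite /= exprS ler_wpM2r ?powR_ge0 // ler_wpM2l // ler_peMl //.
  exact: exprn_ge0.
have [k [t [rE npt]]] := zi_prime_factor pp r0.
have t0 : t != 0 by apply: contraNneq r0 => t0; rewrite rE t0 mulr0.
have /(_ t t0) := IH; rewrite rE => {}IH.
apply: (@le_trans _ _ (k.+1%:R * (size (gdivs t))%:R)).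
  by rewrite -natrM ler_nat gdivs_prime_exp.
rewrite gnM natrM powRM // /= exprS gnX powR_natX.
set B := C ^+ size L; set T := (gn t)%:R `^ eps.
have -> : 9 * (C * B) * ((gn p)%:R `^ eps ^+ k * T) =
  (C * (gn p)%:R `^ eps ^+ k) * (9 * B * T) by ring.
apply: ler_pM => //; last first.
  apply: IH => q qp qt; have [||] := small q qp; [|by left|].
    by rewrite rE mulrC; case: qt => u ->; exists (u * p ^+ k); rewrite mulrA.
  rewrite inE => /predU1P[qE|]; last by right.
  by case: npt; rewrite -qE.
apply: le_trans (hC k) _; rewrite ler_wpM2l // lerXn2r ?nnegrE ?powR_ge0 //.
apply: ge0_ler_powR; rewrite ?nnegrE // (ler_nat R 2); exact: pp.1.
Qed.

Lemma divisor_bound (R : realType) (eps : R) : 0 < eps ->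
  exists2 C : R, 0 < C & forall r : zi, r != 0 ->
  (size (gdivs r))%:R <= C * (gn r)%:R `^ eps.
Proof.
move=> eps0; have eps0' := ltW eps0.
(* The solution of x^eps = 2: every P >= x has P^eps >= 2. *)
pose x : R := 2 `^ eps^-1.
have x0 : 0 <= x by apply: powR_ge0.
pose P := (Num.trunc x).+1.
have hP : 2 <= P%:R `^ eps.
  have {1}-> : 2 = x `^ eps by rewrite -powRrM mulVf ?gt_eqF // powRr1.
  by apply: ge0_ler_powR; rewrite ?nnegrE // ltW // truncnS_gt.
pose t : R := 2 `^ eps - 1.
have t0 : 0 < t.
  by rewrite subr_gt0 -[ltLHS](congr1 (@^~ eps) (@powR1 R)); apply: gt0_ltr_powR; rewrite ?nnegrE ?ltr1n.
(* Chosen so that C (1 + k t) = 1 + k t + 1/t + k >= k + 1, while Bernoulli gives 1 + k t <=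
   (2^eps)^k. *)
pose C := 1 + t^-1; have C1 : 1 <= C by rewrite lerDl invr_ge0 ltW.
exists (9 * C ^+ size (gball P)); first by rewrite mulr_gt0 ?exprn_gt0 ?(lt_le_trans _ C1).
move=> r r0; apply: (@gdivs_small _ _ P) => //.
  move=> k; have := bernoulli_ineq k (ltW t0).
  rewrite subrKC => /(ler_wpM2l (le_trans ler01 C1)); apply: le_trans.
  have -> : C * (1 + k%:R * t) = 1 + k%:R * t + t^-1 + k%:R * (t^-1 * t).
    by rewrite /C; ring.
  rewrite mulVf ?gt_eqF // mulr1 -natr1.
  have : 0 <= k%:R * t by rewrite mulr_ge0 // ltW.
  have : 0 < t^-1 by rewrite invr_gt0.
  lra.
move=> p pp _; have [|/ltnW] := leqP P (gn p); first by left.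
by rewrite -gball_mem; right.
Qed.

Local Open Scope complex_scope.

(** * The large sieve *)

Section Csqnorm.
Variable R : realType.
Implicit Types (z w : R[i]) (x y : R).

Lemma ReD z w : complex.Re (z + w) = complex.Re z + complex.Re w.
Proof. by case: z w => [a b] [c d]. Qed.

Lemma Re_sum (I : Type) (s : seq I) (F : I -> R[i]) :
  complex.Re (\sum_(i <- s) F i) = \sum_(i <- s) complex.Re (F i).
Proof. by apply: (big_morph _ ReD). Qed.

Lemma csqnorm_ge0 z : 0 <= csqnorm z.
Proof. by rewrite addr_ge0 ?sqr_ge0. Qed.

Lemma csqnormE z : (csqnorm z)%:C = z * conjc z.
Proof.
case: z => a b; rewrite /csqnorm /=; apply/eqP; rewrite eq_complex /=.
by apply/andP; split; apply/eqP; ring.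
Qed.

Lemma csqnormM z w : csqnorm (z * w) = csqnorm z * csqnorm w.
Proof. by case: z w => [a b] [c d]; rewrite /csqnorm /=; ring. Qed.

Lemma csqnormN z : csqnorm (- z) = csqnorm z.
Proof. by case: z => [a b]; rewrite /csqnorm /= !sqrrN. Qed.

Lemma csqnorm_conj z : csqnorm (conjc z) = csqnorm z.
Proof. by case: z => [a b]; rewrite /csqnorm /= sqrrN. Qed.

Lemma csqnorm_eq0 z : (csqnorm z == 0) = (z == 0).
Proof.
by case: z => a b; rewrite /csqnorm paddr_eq0 ?sqr_ge0 // !sqrf_eq0 eq_complex.
Qed.

Lemma csqnorm1 : csqnorm (1 : R[i]) = 1.
Proof. by rewrite /csqnorm /= expr1n expr0n addr0. Qed.

Lemma csqnormD_le z w : csqnorm (z + w) <= 2 * (csqnorm z + csqnorm w).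
Proof.
case: z w => [a b] [c d]; rewrite /csqnorm /=.
have := sqr_ge0 (a - c); have := sqr_ge0 (b - d); nra.
Qed.

Lemma csqnormB_le z w : csqnorm (z - w) <= 2 * (csqnorm z + csqnorm w).
Proof. by rewrite -(csqnormN w) csqnormD_le. Qed.

(** Expand B |conj z - w/B|^2 >= 0. *)
Lemma ReM_le z w (B : R) : 0 < B ->
  complex.Re (z * w) <= 2^-1 * (B * csqnorm z + B^-1 * csqnorm w).
Proof.
move=> B0; case: z w => [a b] [c d]; rewrite /csqnorm /=.
have B1 : B * B^-1 = 1 by rewrite divff ?gt_eqF.
have := mulr_ge0 (ltW B0) (sqr_ge0 (a - B^-1 * c)).
have := mulr_ge0 (ltW B0) (sqr_ge0 (b + B^-1 * d)).
have -> : B * (a - B^-1 * c) ^+ 2 =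
  B * a ^+ 2 - 2 * (B * B^-1) * a * c + B * B^-1 * B^-1 * c ^+ 2 by ring.
have -> : B * (b + B^-1 * d) ^+ 2 =
  B * b ^+ 2 + 2 * (B * B^-1) * b * d + B * B^-1 * B^-1 * d ^+ 2 by ring.
by rewrite B1; lra.
Qed.

Lemma csqnorm_sum_le (I : Type) (s : seq I) (F : I -> R[i]) :
  (forall i, csqnorm (F i) <= 1) -> csqnorm (\sum_(i <- s) F i) <= (size s)%:R ^+ 2.
Proof.
move=> F1; have E : csqnorm (\sum_(i <- s) F i) =
    \sum_(i <- s) \sum_(j <- s) complex.Re (F i * conjc (F j)).
  rewrite -[LHS]/(complex.Re (csqnorm (\sum_(i <- s) F i))%:C) csqnormE rmorph_sum.
  rewrite mulr_suml Re_sum; apply: eq_bigr => i _.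
  by rewrite mulr_sumr Re_sum.
rewrite E; apply: (@le_trans _ _ (\sum_(i <- s) \sum_(j <- s) 1)).
  apply: ler_sum => i _; apply: ler_sum => j _.
  apply: le_trans (ReM_le _ _ ltr01) _; rewrite invr1 !mul1r csqnorm_conj.
  have := F1 i; have := F1 j; lra.
rewrite !big_const_seq !count_predT !iter_addr !addr0.
by rewrite -mulrnA expr2 natrM.
Qed.

(* The weight [B] in the inequality [ReM_le] plays the role of Cauchy-Schwarz: it gives
   [T <= (B Z + T) / 2] for the left-hand side [T]. *)
Lemma large_sieve_duality (I J : Type) (sI : seq I) (sJ : seq J) (e : I -> J -> R[i])
    (B : R) : 0 < B ->
  (forall b : J -> R[i], \sum_(n <- sI) csqnorm (\sum_(j <- sJ) b j * e n j) <=
      B * \sum_(j <- sJ) csqnorm (b j)) ->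
  forall c : I -> R[i], \sum_(j <- sJ) csqnorm (\sum_(n <- sI) c n * e n j) <=
      B * \sum_(n <- sI) csqnorm (c n).
Proof.
move=> B0 dual c; pose S j := \sum_(n <- sI) c n * e n j.
pose g n := \sum_(j <- sJ) conjc (S j) * e n j.
set T := \sum_(j <- sJ) _.
have TE : T = \sum_(n <- sI) complex.Re (c n * g n).
  rewrite -Re_sum -[LHS]/(complex.Re T%:C) /T rmorph_sum /=; congr complex.Re.
  under eq_bigr => j _ do rewrite csqnormE mulr_suml.
  rewrite exchange_big /=; apply: eq_bigr => n _; rewrite mulr_sumr.
  by apply: eq_bigr => j _; rewrite -mulrA [e n j * _]mulrC.
have := dual (fun j => conjc (S j)).
under [X in _ <= B * X -> _]eq_bigr => j _ do rewrite csqnorm_conj.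
rewrite -[\sum_(j <- sJ) csqnorm (S j)]/T => gT.
have : T <= \sum_(n <- sI) 2^-1 * (B * csqnorm (c n) + B^-1 * csqnorm (g n)).
  by rewrite {1}TE; apply: ler_sum => n _; apply: ReM_le.
rewrite -mulr_sumr big_split /= -!mulr_sumr.
have : B^-1 * \sum_(n <- sI) csqnorm (g n) <= T.
  by rewrite mulrC ler_pdivrMr // mulrC.
lra.
Qed.

End Csqnorm.

(** * The Fejer kernel *)

Section Kernel.
Variable R : realType.
Implicit Types (x y : R).

Lemma eeD x y : ee (x + y) = ee x * ee y.
Proof.
apply/eqP; rewrite eq_complex /= !mulrDr cosD sinD; apply/andP; split => //.
by apply/eqP; ring.
Qed.

Lemma ee0 : ee (0 : R) = 1.
Proof. by rewrite /ee mulr0 cos0 sin0. Qed.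

Lemma eeN x : ee (- x) = conjc (ee x).
Proof. by rewrite /ee mulrN cosN sinN. Qed.

Lemma csqnorm_ee x : csqnorm (ee x) = 1.
Proof. exact: cos2Dsin2. Qed.

Lemma ee1 : ee (1 : R) = 1.
Proof. by rewrite /ee mulr1 mulr_natl cos2pi sin2pi. Qed.

Lemma ee_natM n x : ee (n%:R * x) = ee x ^+ n.
Proof.
elim: n => [|n IH]; first by rewrite mul0r ee0 expr0.
by rewrite -natr1 mulrDl mul1r eeD IH exprSr.
Qed.

Lemma ee_int (k : int) : ee (k%:~R : R) = 1.
Proof.
case: k => n; first by rewrite -[(Posz n)%:~R]mulr1 ee_natM ee1 expr1n.
by rewrite NegzE mulrNz eeN -[_%:~R]mulr1 ee_natM ee1 expr1n conjc1.
Qed.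

Lemma sin_piquarter_ge : 2^-1 <= sin (pi / 4 : R).
Proof.
have p2 := @pi_ge2 R.
have c0 : 0 <= cos (pi / 4 : R) by apply: cos_ge0_pihalf; lra.
have s0 : 0 <= sin (pi / 4 : R) by apply: sin_ge0_pi; lra.
have := cos2Dsin2 (pi / 4 : R).
have E : sin (pi / 4) = cos (pi / 4) :> R.
  have := @tan_piquarter R; rewrite /tan => /(congr1 ( *%R^~ (cos (pi / 4)))).
  rewrite mul1r mulfVK // gt_eqF //; apply: cos_gt0_pihalf; lra.
rewrite -E in c0 *; nra.
Qed.

(* [sin (2 t) <= 2 sin t] carries the bound from [pi / 4, pi / 2] down to smaller [t]. *)
Lemma sin_ge_quarter_dyadic k (t : R) : pi / 4 <= t * 2 ^+ k -> t <= pi / 2 ->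
  t / 4 <= sin t :> R.
Proof.
have p2 := @pi_ge2 R.
have base (u : R) : pi / 4 <= u -> u <= pi / 2 -> u / 4 <= sin u.
  move=> t4 t2; apply: (@le_trans _ _ 2^-1); first by have := @pihalf_lt2 R; lra.
  apply: (le_trans sin_piquarter_ge).
  rewrite le_eqVlt; have [->|ne] := eqVneq u (pi / 4); first by rewrite eqxx.
  by rewrite ltr_sin ?in_itv /= ?lt_def ?ne ?t4 ?orbT //; apply/andP; split; lra.
elim: k t => [|k IH] t; first by rewrite expr0 mulr1; exact: base.
move=> tk t2; have [/base|t4] := leP (pi / 4) t; first exact.
have : 0 < t by rewrite -(pmulr_lgt0 _ (exprn_gt0 k.+1 (ltr0Sn R 1))); lra.
move=> t0; have /IH : pi / 4 <= (t *+ 2) * 2 ^+ k.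
  by rewrite -[t *+ 2]mulr_natr -mulrA -exprS.
have E (u : R) : u *+ 2 = 2 * u by rewrite mulr_natl.
rewrite sin_mulr2n (E t) (E (cos t * sin t)) => /(_ ltac:(lra)) IHt.
have s0 : 0 <= sin t by apply: sin_ge0_pi; lra.
have : sin t * cos t <= sin t by rewrite ler_piMr // cos_le1.
lra.
Qed.

Lemma sin_ge_quarter (t : R) : 0 <= t <= pi / 2 -> t / 4 <= sin t :> R.
Proof.
move=> /andP[t0 t2]; have p2 := @pi_ge2 R.
have [->|tn0] := eqVneq t 0; first by rewrite sin0 mul0r.
have tp : 0 < t by rewrite lt_def tn0.
(* Any k >= (pi/4)/t will do, because 2^k > k. *)
pose k := (Num.trunc (pi / 4 / t)).+1; apply: (@sin_ge_quarter_dyadic k) => //.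
rewrite [t * _]mulrC -ler_pdivrMr //; apply: le_trans (ltW (truncnS_gt _)) _; rewrite -/k.
by rewrite -natrX ler_nat ltnW // ltn_expl.
Qed.

(** |e(x) - 1| = 2 |sin(pi x)|, and sin(pi y) >= pi y/4 >= y/2 for 0 <= y <= 1/2. *)
Lemma csqnorm_ee_sub1 x : `|x| <= 2^-1 -> x ^+ 2 <= csqnorm (ee x - 1).
Proof.
move=> x2; have E : csqnorm (ee x - 1) = 4 * sin (pi * x) ^+ 2.
  rewrite /csqnorm /= subr0.
  have -> : 2 * pi * x = (pi * x) *+ 2 by rewrite -mulrA mulr_natl.
  have E (u : R) : u *+ 2 = 2 * u by rewrite mulr_natl.
  rewrite cos_mulr2n sin_mulr2n cos2sin2 (E (1 - _)) (E (cos _ * _)).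
  have := cos2Dsin2 (pi * x); move: (cos _) (sin _) => c s cs.
  have -> : (2 * (c * s)) ^+ 2 = 4 * c ^+ 2 * s ^+ 2 by ring.
  have -> : c ^+ 2 = 1 - s ^+ 2 by rewrite -cs; ring.
  by ring.
rewrite E.
have -> : sin (pi * x) ^+ 2 = sin (pi * `|x|) ^+ 2.
  by case: (ger0P x) => // _; rewrite mulrN sinN sqrrN.
rewrite -real_normK ?num_real //; have p2 := @pi_ge2 R; have x0 := normr_ge0 x.
have := @sin_ge_quarter (pi * `|x|); move: `|x| x0 x2 => y y0 y2.
have py : 2 * y <= pi * y by rewrite ler_wpM2r.
rewrite mulr_ge0 ?(le_trans _ p2) //= => /(_ ltac:(nra)) sy.
nra.
Qed.

(* [L] times the Fejer kernel. *)
Definition dker (L : nat) x := csqnorm (\sum_(u < L) ee (u%:R * x)).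

Lemma dker_ge0 L x : 0 <= dker L x. Proof. exact: csqnorm_ge0. Qed.

Lemma dkerN L x : dker L (- x) = dker L x.
Proof.
rewrite /dker -(csqnorm_conj (\sum_(u < L) ee (u%:R * x))) rmorph_sum /=.
by congr csqnorm; apply: eq_bigr => u _; rewrite mulrN eeN.
Qed.

Lemma dkerD_int L x (k : int) : dker L (x + k%:~R) = dker L x.
Proof.
congr csqnorm; apply: eq_bigr => u _; rewrite mulrDr eeD.
by rewrite -[u%:R in X in _ * X]/((u%:Z)%:~R) -intrM ee_int mulr1.
Qed.

(** The trivial bound L^2 gives one of the five; the geometric series gives x^2 [dker L x] <= |e(Lx)
    - 1|^2 <= 4, hence the other four. *)
Lemma dker_le L x : `|x| <= 2^-1 -> dker L x * (1 + (L%:R * x) ^+ 2) <= 5 * L%:R ^+ 2.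
Proof.
move=> x2; have D1 : dker L x <= L%:R ^+ 2.
  have {2}-> : L = size (index_enum 'I_L).
    by rewrite -[index_enum _]enumT size_enum_ord.
  by apply: csqnorm_sum_le => u; rewrite csqnorm_ee.
have D2 : x ^+ 2 * dker L x <= 4.
  apply: (@le_trans _ _ (csqnorm (ee x - 1) * dker L x)).
    by rewrite ler_wpM2r ?dker_ge0 // csqnorm_ee_sub1.
  rewrite -csqnormM; under eq_bigr => u _ do rewrite ee_natM.
  rewrite -subrX1 -ee_natM; apply: (le_trans (csqnormB_le _ _)).
  by rewrite csqnorm_ee csqnorm1; lra.
have L0 : 0 <= L%:R ^+ 2 :> R by rewrite exprn_ge0.
have := ler_wpM2l L0 D2; rewrite exprMn.
have -> : dker L x * (1 + L%:R ^+ 2 * x ^+ 2) =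
  dker L x + L%:R ^+ 2 * (x ^+ 2 * dker L x) by ring.
lra.
Qed.

(** The decay of [dker L], relative to L^2, at distance about s/L from the integers. *)
Definition binw (s : int) : R := (1 + s%:~R ^+ 2)^-1.

Lemma binw_ge0 s : 0 <= binw s.
Proof. by rewrite invr_ge0 addr_ge0 // sqr_ge0. Qed.

Lemma irangeS K : perm_eq (irange K.+1) [:: K.+1%:Z, - K.+1%:Z & irange K].
Proof.
apply: uniq_perm; first exact: irange_uniq.
  by rewrite 2!cons_uniq inE !irange_mem irange_uniq; lia.
by move=> x; rewrite irange_mem 2!in_cons irange_mem; lia.
Qed.

Lemma sum_irangeS (f : int -> R) K : \sum_(s <- irange K.+1) f s =
  f K.+1%:Z + (f (- K.+1%:Z) + \sum_(s <- irange K) f s).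
Proof. by rewrite (perm_big _ (irangeS K)) 2!big_cons. Qed.

Lemma binw_sum K : \sum_(s <- irange K) binw s <= 5.
Proof.
(* The sharper bound telescopes: with n = K + 1, the two new terms are 2/(1 + n^2) <= 4/n - 4/(n +
   1). *)
apply: (@le_trans _ _ (5 - 4 / K.+1%:R)); last by rewrite gerBl divr_ge0.
elim: K => [|K IH].
  by rewrite /irange /= big_seq1 /binw subrr expr0n addr0 invr1; lra.
rewrite sum_irangeS.
have -> : binw (- K.+1%:Z) = binw K.+1%:Z by rewrite /binw mulrNz sqrrN.
suff : 2 * binw K.+1%:Z <= 4 / K.+1%:R - 4 / K.+2%:R.
  by move: IH; set p := _ / K.+1%:R; set q := _ / K.+2%:R; lra.
rewrite /binw -[(K.+1%:Z)%:~R]/(K.+1%:R) -(natr1 K.+1) -(natr1 K).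
have : 0 <= K%:R :> R by []; move: K%:R => a a0.
have -> : 4 / (a + 1) - 4 / (a + 1 + 1) = 4 / ((a + 1) * (a + 1 + 1)).
  by field; rewrite !gt_eqF //; lra.
rewrite ler_pdivlMr; last by nra.
rewrite mulrAC ler_pdivrMr; last by nra.
nra.
Qed.

(** [k] is an integer nearest to x, and s/L is the left end of the cell of length 1/L containing x -
    k. The 15 is the 5 of [dker_le] times 3, the price of replacing L(x - k) by its floor [s]. *)
Lemma dker_bin L x : (0 < L)%N -> exists (k s : int),
  [/\ s \in irange L.+1, 0 <= x - k%:~R - s%:~R / L%:R <= L%:R^-1 &
   dker L x <= 15 * L%:R ^+ 2 * binw s].
Proof.
move=> L0; pose k := Num.floor (x + 2^-1); pose y := x - k%:~R.
have /andP[k1 k2] := floor_itv (x + 2^-1).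
rewrite -/k intrD in k1 k2.
have y2 : `|y| <= 2^-1 by rewrite ler_norml /y; lra.
have Lp : 0 < L%:R :> R by rewrite ltr0n.
pose s := Num.floor (L%:R * y).
have /andP[s1 s2] := floor_itv (L%:R * y).
rewrite -/s intrD in s1 s2.
exists k, s; split.
- rewrite irange_mem; have : `|s%:~R : R| <= L.+1%:R.
    move: y2; rewrite !ler_norml -(natr1 L) => /andP[ya yb].
    have := ler_wpM2l (ltW Lp) ya; have := ler_wpM2l (ltW Lp) yb.
    by move=> *; apply/andP; split; lra.
  by rewrite -intr_norm -[L.+1%:R]/((L.+1%:Z)%:~R) ler_int; lia.
- rewrite -/y; apply/andP; split.
    by rewrite subr_ge0 ler_pdivrMr // mulrC.
  rewrite lerBlDr (_ : _ + _ = (s%:~R + 1) / L%:R); last by rewrite mulrDl mul1r addrC.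
  by rewrite ler_pdivlMr // mulrC ltW.
have -> : dker L x = dker L y by rewrite /y -(dkerD_int L y k) /y subrK.
have := dker_le L y2; move: (dker_ge0 L y) (sqr_ge0 (L%:R : R)).
have : 1 + s%:~R ^+ 2 <= 3 * (1 + (L%:R * y) ^+ 2).
  move: (L%:R * y) s1 s2 => t s1 s2.
  have [s0|s0] := leP 0 s.
    have : 0 <= s%:~R :> R by rewrite ler0z.
    nra.
  have : s%:~R <= -1 :> R by rewrite -(mulrNz 1 1) ler_int; lia.
  move: s1 s2; move: s%:~R => a s1 s2 a0; rewrite expr2 in s1 s2 *.
  have := sqr_ge0 (t - a); have := sqr_ge0 (2 * t - a); nra.
move=> H D0 L2 D5; rewrite /binw ler_pdivlMr ?ltr_pwDl ?sqr_ge0 //.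
by have := ler_wpM2l D0 H; lra.
Qed.
End Kernel.

(** * The large sieve for points of the torus, from their local density *)

Section LargeSieve.
Local Arguments ee : simpl never.
Variable R : realType.

Lemma ler_sum_subset (T : eqType) (s1 s2 : seq T) (F : T -> R) :
  uniq s1 -> {subset s1 <= s2} -> (forall x, 0 <= F x) ->
  \sum_(x <- s1) F x <= \sum_(x <- s2) F x.
Proof.
move=> + + F0; elim: s1 s2 => [|x s1 IH] s2 /=.
  by rewrite big_nil sumr_ge0.
move=> /andP[xs1 us1] sub; have xs2 : x \in s2 by apply: sub; rewrite mem_head.
rewrite big_cons (big_rem x xs2) lerD2l; apply: IH => // y ys1.
have := sub y; rewrite inE ys1 orbT => /(_ isT) ys2.
by have := perm_mem (perm_to_rem xs2) y; rewrite ys2 inE => /esym /predU1P[yx|//];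
  move: xs1; rewrite -yx ys1.
Qed.

Lemma ler_sum_mem (T : eqType) (s : seq T) (F : T -> R) (x : T) :
  x \in s -> (forall y, 0 <= F y) -> F x <= \sum_(y <- s) F y.
Proof.
move=> xs F0; rewrite -[leLHS](big_seq1 +%R x F).
by apply: ler_sum_subset => // y; rewrite inE => /eqP->.
Qed.

Lemma sum_count (T : Type) (s : seq T) (p : pred T) :
  \sum_(x <- s) (p x)%:R = (count p s)%:R :> R.
Proof.
by elim: s => [|x s IH]; rewrite ?big_nil // big_cons IH /= natrD.
Qed.

Definition diffs (L : nat) : seq int :=
  [seq u%:Z - v%:Z | v <- iota 0 L, u <- iota 0 L].

(* Each [n] in [-M, M] is a difference [u - v] for every [v] in [M, 2M], so [diffs] counts it
   at least [M + 1] times: these are the Fejer weights. *)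
Lemma sum_diffs_ge (G : int -> R) M : (forall n, 0 <= G n) ->
  M.+1%:R * \sum_(n <- irange M) G n <= \sum_(d <- diffs (3 * M).+1) G d.
Proof.
move=> G0; rewrite big_allpairs_dep.
apply: (@le_trans _ _ (\sum_(v <- iota M M.+1) \sum_(n <- irange M) G n)).
  by rewrite big_const_seq count_predT size_iota iter_addr addr0 mulr_natl.
apply: (@le_trans _ _ (\sum_(v <- iota M M.+1) \sum_(u <- iota 0 (3 * M).+1) G (u%:Z - v%:Z))).
  rewrite big_seq [leRHS]big_seq; apply: ler_sum => v; rewrite mem_iota => vM.
  rewrite -(big_map (fun u : nat => u%:Z - v%:Z) xpredT G).
  apply: ler_sum_subset (irange_uniq M) _ G0 => n; rewrite irange_mem => nM.
  by apply/mapP; exists `|(n + v%:Z)%R|%N; rewrite ?mem_iota; lia.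
apply: ler_sum_subset; first exact: iota_uniq.
  by move=> v; rewrite !mem_iota; lia.
by move=> v; apply: sumr_ge0.
Qed.

Lemma sum_diffs_ee L (x : R) : \sum_(d <- diffs L) ee (d%:~R * x) = (dker L x)%:C.
Proof.
rewrite big_allpairs_dep csqnormE rmorph_sum mulr_sumr.
rewrite -(big_mkord xpredT (fun v => _ * conjc (ee (v%:R * x)))) /index_iota subn0.
apply: eq_bigr => v _.
rewrite -(big_mkord xpredT (fun u => ee (u%:R * x))) /index_iota subn0 mulr_suml.
by apply: eq_bigr => u _; rewrite intrB mulrBl eeD eeN.
Qed.

Variables (J : Type) (sJ : seq J) (alpha : J -> R[i]).

(** Sort the points by the cell of side 1/L, modulo Z[i], containing z - alpha_j. A cell lies in a
    disc of squared radius 2/L^2, so it holds at most [K] points. The weights of all cells sum to at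
    most 5 * 5, and 5625 = 15^2 * 25. *)
Lemma dker_row_sum (L : nat) (K : R) : (0 < L)%N ->
  (forall beta, (count (fun j => `[< exists k : zi,
     csqnorm (alpha j + gC R k - beta) <= 2 / L%:R ^+ 2 >]) sJ)%:R <= K) ->
  forall z, \sum_(j <- sJ) dker L (complex.Re (z - alpha j)) *
     dker L (complex.Im (z - alpha j)) <= 5625 * K * L%:R ^+ 4.
Proof.
move=> L0 hK z; have Lp : 0 < L%:R :> R by rewrite ltr0n.
pose c (s1 s2 : int) j := `[< exists k : zi, csqnorm (alpha j + gC R k -
  (z - ((s1%:~R / L%:R) +i* (s2%:~R / L%:R)))) <= 2 / L%:R ^+ 2 >].
pose A := (15 * L%:R ^+ 2 : R) ^+ 2; have A0 : 0 <= A by apply: sqr_ge0.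
have K0 : 0 <= K by apply: le_trans (hK 0).
have step j : dker L (complex.Re (z - alpha j)) * dker L (complex.Im (z - alpha j))
  <= \sum_(s1 <- irange L.+1) \sum_(s2 <- irange L.+1)
     A * (binw R s1 * binw R s2) * (c s1 s2 j)%:R.
  have [k1 [s1 [m1 b1 d1]]] := dker_bin (complex.Re (z - alpha j)) L0.
  have [k2 [s2 [m2 b2 d2]]] := dker_bin (complex.Im (z - alpha j)) L0.
  have F0 t1 t2 : 0 <= A * (binw R t1 * binw R t2) * (c t1 t2 j)%:R.
    by rewrite !mulr_ge0 ?binw_ge0.
  apply: le_trans (ler_sum_mem m1 _); last by move=> t1; apply: sumr_ge0.
  apply: le_trans (ler_sum_mem m2 (F0 s1)).
  have -> : c s1 s2 j = true.
    apply/asboolP; exists ((k1, k2) : zi).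
    clear F0 c d1 d2; move: b1 b2; case: z (alpha j) => [z1 z2] [a1 a2]; rewrite /csqnorm /=.
    rewrite -exprVn; move: L%:R^-1 (s1%:~R / L%:R) (s2%:~R / L%:R) => l t1 t2.
    move: k1%:~R k2%:~R => k1' k2' /andP[b1 b1'] /andP[b2 b2'].
    by nra.
  rewrite mulr1; apply: le_trans (ler_pM (dker_ge0 _ _) (dker_ge0 _ _) d1 d2) _.
  by rewrite /A; lra.
apply: le_trans (ler_sum _ (fun j _ => step j)) _.
rewrite exchange_big /=.
apply: (@le_trans _ _ (\sum_(s1 <- irange L.+1) \sum_(s2 <- irange L.+1)
   A * (binw R s1 * binw R s2) * K)).
  apply: ler_sum => s1 _; rewrite exchange_big /=; apply: ler_sum => s2 _.
  rewrite -mulr_sumr sum_count; apply: ler_wpM2l; last exact: hK.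
  by rewrite !mulr_ge0 ?binw_ge0.
pose S := \sum_(s <- irange L.+1) binw R s.
have -> : \sum_(s1 <- irange L.+1) \sum_(s2 <- irange L.+1)
   A * (binw R s1 * binw R s2) * K = A * K * (S * S).
  rewrite [S * S]mulr_suml mulr_sumr; apply: eq_bigr => s1 _.
  by rewrite !mulr_sumr; apply: eq_bigr => s2 _; ring.
have S5 : S <= 5 := binw_sum R L.+1.
have S0 : 0 <= S by apply: sumr_ge0 => s _; apply: binw_ge0.
have -> : 5625 * K * L%:R ^+ 4 = A * K * 25 by rewrite /A; ring.
by apply: ler_wpM2l; [apply: mulr_ge0 | nra].
Qed.

Lemma conjcM (z w : R[i]) : conjc (z * w) = conjc z * conjc w.
Proof. exact: rmorphM. Qed.

Lemma conjc_sum (I : Type) (s : seq I) (F : I -> R[i]) :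
  conjc (\sum_(i <- s) F i) = \sum_(i <- s) conjc (F i).
Proof. exact: rmorph_sum. Qed.

(** Re(n alpha) = n_1 Re alpha - n_2 Im alpha separates the coordinates, so the kernel is a product
    of two; evenness of [dker] absorbs the sign. *)
Lemma dker_form (L : nat) (b : J -> R[i]) :
  \sum_(d1 <- diffs L) \sum_(d2 <- diffs L) csqnorm (\sum_(j <- sJ)
     b j * ee (complex.Re (gC R (d1, d2) * alpha j))) =
  \sum_(j <- sJ) \sum_(j' <- sJ) complex.Re (b j * conjc (b j')) *
    (dker L (complex.Re (alpha j - alpha j')) * dker L (complex.Im (alpha j - alpha j'))).
Proof.
have E d1 d2 : csqnorm (\sum_(j <- sJ) b j * ee (complex.Re (gC R (d1, d2) * alpha j))) =
    \sum_(j <- sJ) \sum_(j' <- sJ) complex.Re (b j * conjc (b j') *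
      (ee (d1%:~R * complex.Re (alpha j - alpha j')) *
       ee (d2%:~R * - complex.Im (alpha j - alpha j')))).
  rewrite -[LHS]/(complex.Re (csqnorm _)%:C) csqnormE conjc_sum mulr_suml Re_sum.
  apply: eq_bigr => j _; rewrite mulr_sumr Re_sum; apply: eq_bigr => j' _.
  rewrite conjcM -eeD -eeN mulrACA -eeD.
  congr (complex.Re (_ * ee _)).
  by case: (alpha j) (alpha j') => [x y] [x' y'] /=; ring.
under eq_bigr => d1 _ do (under eq_bigr => d2 _ do rewrite E).
under eq_bigr => d1 _ do rewrite exchange_big.
rewrite exchange_big /=; apply: eq_bigr => j _.
under eq_bigr => d1 _ do rewrite exchange_big.
rewrite exchange_big /=; apply: eq_bigr => j' _.
under eq_bigr => d1 _ do rewrite -Re_sum -mulr_sumr -mulr_sumr sum_diffs_ee.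
rewrite -Re_sum -mulr_sumr -mulr_suml sum_diffs_ee dkerN -rmorphM.
by case: (_ * conjc _) => x y /=; ring.
Qed.

(** The ball lies in the box [-M, M]^2, where the Fejer weights are at least (M + 1)^2. Dividing by
    this, L^4 <= 81 (M + 1)^4 leaves (M + 1)^2, and 5625 * 81 = 675^2. *)
Lemma dual_large_sieve (N M : nat) (K : R) : (N < M.+1 ^ 2)%N ->
  (forall beta, (count (fun j => `[< exists k : zi,
     csqnorm (alpha j + gC R k - beta) <= 2 / (3 * M).+1%:R ^+ 2 >]) sJ)%:R <= K) ->
  forall b : J -> R[i], \sum_(n <- gball N) csqnorm (\sum_(j <- sJ)
     b j * ee (complex.Re (gC R n * alpha j))) <=
    (675 * 675) * K * M.+1%:R ^+ 2 * \sum_(j <- sJ) csqnorm (b j).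
Proof.
move=> NM hK b; set L := (3 * M).+1 in hK.
have K0 : 0 <= K by apply: le_trans (hK 0).
pose G (n : gint) := csqnorm (\sum_(j <- sJ) b j * ee (complex.Re (gC R n * alpha j))).
have G0 n : 0 <= G n by apply: csqnorm_ge0.
pose P j j' := dker L (complex.Re (alpha j - alpha j')) *
  dker L (complex.Im (alpha j - alpha j')).
have P0 j j' : 0 <= P j j' by rewrite mulr_ge0 ?dker_ge0.
have PC j j' : P j j' = P j' j.
  rewrite /P -(dkerN L (complex.Re _)) -(dkerN L (complex.Im _)).
  by case: (alpha j) (alpha j') => [x y] [x' y'] /=; rewrite !opprB.
have M0 : 0 < M.+1%:R :> R by rewrite ltr0n.
have H1 : M.+1%:R ^+ 2 * \sum_(n <- gball N) G n <=
    \sum_(j <- sJ) \sum_(j' <- sJ) complex.Re (b j * conjc (b j')) * P j j'.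
  rewrite -dker_form.
  apply: (@le_trans _ _ (M.+1%:R * \sum_(d1 <- diffs L) \sum_(n2 <- irange M) G (d1, n2))).
    rewrite expr2 -mulrA ler_wpM2l ?(ltW M0) //.
    pose G1 d1 := \sum_(n2 <- irange M) G (d1, n2).
    have G10 d1 : 0 <= G1 d1 by apply: sumr_ge0.
    apply: (le_trans _ (sum_diffs_ge M G10)).
    rewrite ler_wpM2l ?(ltW M0) //.
    have -> : \sum_(n1 <- irange M) G1 n1 =
        \sum_(n <- [seq (x, y) | x <- irange M, y <- irange M]) G n.
      by rewrite big_allpairs_dep.
    apply: ler_sum_subset => //; first exact: gball_uniq.
    move=> n nN; have : n \in [seq (x, y) | x <- irange M, y <- irange M].
      rewrite ipairs_mem; have := gball_mem N (n : zi); rewrite nN gn_abs => /esym nN'.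
      by apply/andP; split; nia.
    exact.
  rewrite mulr_sumr; apply: ler_sum => d1 _.
  exact: (sum_diffs_ge (G := fun d2 => G (d1, d2))).
(* Schur's test: bound Re(b_j conj b_j') by the mean of |b_j|^2 and |b_j'|^2; the symmetry of [P]
   makes both halves equal. *)
have H2 : \sum_(j <- sJ) \sum_(j' <- sJ) complex.Re (b j * conjc (b j')) * P j j' <=
   \sum_(j <- sJ) csqnorm (b j) * \sum_(j' <- sJ) P j j'.
  pose F j j' := csqnorm (b j) * P j j'.
  have -> : \sum_(j <- sJ) csqnorm (b j) * \sum_(j' <- sJ) P j j' =
      2^-1 * (\sum_(j <- sJ) \sum_(j' <- sJ) F j j') +
      2^-1 * (\sum_(j <- sJ) \sum_(j' <- sJ) F j' j).
    rewrite (exchange_big _ _ _ _ _ (fun j j' => F j' j)) /=.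
    under eq_bigr => j _ do rewrite mulr_sumr.
    by rewrite -mulrDl; set S := \sum_(_ <- _) _; lra.
  rewrite !mulr_sumr -big_split; apply: ler_sum => j _ /=.
  rewrite !mulr_sumr -big_split; apply: ler_sum => j' _ /=.
  rewrite /F (PC j' j); have := ReM_le (b j) (conjc (b j')) ltr01.
  rewrite csqnorm_conj invr1 !mul1r => /(ler_wpM2r (P0 j j')).
  lra.
have H3 : \sum_(j <- sJ) csqnorm (b j) * \sum_(j' <- sJ) P j j' <=
    5625 * K * L%:R ^+ 4 * \sum_(j <- sJ) csqnorm (b j).
  rewrite mulr_sumr; apply: ler_sum => j _; rewrite mulrC ler_wpM2r ?csqnorm_ge0 //.
  exact: dker_row_sum.
have L4 : L%:R ^+ 4 <= 81 * M.+1%:R ^+ 4 :> R.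
  rewrite -(natrX _ M.+1) -natrX -natrM ler_nat.
  by rewrite -[81%N]/(3 ^ 4)%N -expnMn leq_exp2r // /L; lia.
rewrite -(ler_pM2l (exprn_gt0 2 M0)); apply: (le_trans H1 (le_trans H2 (le_trans H3 _))).
have Z0 : 0 <= \sum_(j <- sJ) csqnorm (b j) by apply: sumr_ge0 => j _; apply: csqnorm_ge0.
rewrite [leRHS]mulrA; apply: ler_wpM2r => //.
have := ler_wpM2l K0 L4; lra.
Qed.

End LargeSieve.

Lemma large_sieve (R : realType) (J : Type) (sJ : seq J) (alpha : J -> R[i])
    (N M : nat) (K : R) : 0 < K -> (M ^ 2 <= N < M.+1 ^ 2)%N -> (0 < N)%N ->
  (forall beta, (count (fun j => `[< exists k : zi,
     csqnorm (alpha j + gC R k - beta) <= N%:R^-1 >]) sJ)%:R <= K) ->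
  forall c : gint -> R[i], \sum_(j <- sJ) csqnorm (\sum_(n <- gball N)
     c n * ee (complex.Re (gC R n * alpha j))) <=
    (1350 * 1350) * K * N%:R * \sum_(n <- gball N) csqnorm (c n).
Proof.
move=> K0 /andP[MN NM] N0 hK c.
have M0 : (0 < M)%N by case: (M) NM; lia.
have N0' : 0 < N%:R :> R by rewrite ltr0n.
apply: le_trans (large_sieve_duality (B := (675 * 675) * K * M.+1%:R ^+ 2) _ _ c) _.
- by rewrite !mulr_gt0 ?exprn_gt0.
- apply: dual_large_sieve => // beta; apply: le_trans (hK beta).
  (* The discs of squared radius 2/(3M + 1)^2 fit into those of squared radius 1/N, because 2N <=
     (3M + 1)^2. *)
  rewrite ler_nat; apply: sub_count => j /asboolP[k H]; apply/asboolP; exists k.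
  apply: le_trans H _; rewrite ler_pdivrMr ?exprn_gt0 ?ltr0n //.
  rewrite mulrC ler_pdivlMr // -natrX -natrM ler_nat; nia.
apply: ler_wpM2r; first by apply: sumr_ge0 => n _; apply: csqnorm_ge0.
have : M.+1%:R ^+ 2 <= 4 * N%:R :> R by rewrite -natrX -natrM ler_nat; nia.
by move=> /(ler_wpM2l (ltW K0)); lra.
Qed.

(** * Counting fractions near a point *)

Section Embedding.
Variable R : realType.

Lemma gCM (a b : zi) : gC R (a * b) = gC R a * gC R b.
Proof. by rewrite /gC !(intrM, intrD, intrB, mulrNz). Qed.

Lemma gCD (a b : zi) : gC R (a + b) = gC R a + gC R b.
Proof. by rewrite /gC !intrD. Qed.

Lemma gCN (a : zi) : gC R (- a) = - gC R a.
Proof. by rewrite /gC !mulrNz. Qed.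

Lemma gCB (a b : zi) : gC R (a - b) = gC R a - gC R b.
Proof. by rewrite gCD gCN. Qed.

Lemma csqnorm_gC (a : zi) : csqnorm (gC R a) = (gn a)%:R.
Proof.
by rewrite -[RHS]/((gn a)%:Z%:~R) gnE /gnorm /csqnorm /= intrD !expr2 !intrM.
Qed.

Lemma gC_eq0 (a : zi) : (gC R a == 0) = (a == 0).
Proof. by rewrite -csqnorm_eq0 csqnorm_gC pnatr_eq0 gn_eq0. Qed.

(** Pigeonhole: (H + 1)^2 multipliers with coordinates in 0..H, against H^2 cells of side 1/H for
    the fractional parts of their products with beta. *)
Lemma zi_dirichlet (beta : R[i]) (H : nat) : (0 < H)%N -> exists r b : zi,
  [/\ r != 0, (gn r <= 2 * H ^ 2)%N &
     csqnorm (beta * gC R r - gC R b) <= 2 / H%:R ^+ 2].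
Proof.
case: H => // H' _; set H := H'.+1; have H0 : 0 < H%:R :> R by rewrite ltr0n.
pose pt (u : 'I_H.+1 * 'I_H.+1) : zi := (u.1%:Z, u.2%:Z).
pose w u := beta * gC R (pt u).
pose fr (x : R) := x - (Num.floor x)%:~R.
have fr0 x : 0 <= fr x by rewrite subr_ge0; have /andP[] := floor_itv x.
have fr1 x : fr x < 1.
  by have /andP[_] := floor_itv x; rewrite /fr intrD; lra.
pose bin (x : R) : 'I_H := inord `|Num.floor (H%:R * fr x)|%N.
have bin_eq x y : bin x = bin y -> `|fr x - fr y| <= H%:R^-1.
  have P t : 0 <= Num.floor (H%:R * fr t) < H%:Z.
    have /andP[t1 t2] := floor_itv (H%:R * fr t).
    have tH : H%:R * fr t < H%:R by rewrite -[ltRHS]mulr1 ltr_pM2l.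
    have t0 : 0 <= H%:R * fr t by rewrite mulr_ge0 ?(ltW H0).
    apply/andP; split; last by rewrite -(ltr_int R) (le_lt_trans t1).
    by rewrite -ltzD1 -(ltr_int R) (le_lt_trans t0).
  move=> /(congr1 val); rewrite /= !inordK; last 2 first.
  - by have := P y; lia.
  - by have := P x; lia.
  move=> E; have {}E : Num.floor (H%:R * fr x) = Num.floor (H%:R * fr y).
    by have := P x; have := P y; lia.
  have /andP[x1 x2] := floor_itv (H%:R * fr x).
  have /andP[y1 y2] := floor_itv (H%:R * fr y).
  rewrite E intrD in x1 x2; rewrite intrD in y2.
  rewrite -(ler_pM2l H0) mulfV ?gt_eqF // -[H%:R in leLHS](gtr0_norm H0) -normrM mulrBr.
  by rewrite ler_norml; apply/andP; split; lra.
pose f u := (bin (complex.Re (w u)), bin (complex.Im (w u))).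
have /injectivePn[u [v uv fuv]] : ~~ injectiveb f.
  apply/negP => /injectiveP/leq_card; rewrite !card_prod !card_ord.
  by rewrite leqNgt => /negP; apply; rewrite ltn_mul.
exists (pt u - pt v), ((Num.floor (complex.Re (w u)) - Num.floor (complex.Re (w v)),
   Num.floor (complex.Im (w u)) - Num.floor (complex.Im (w v))) : zi); split.
- apply: contraNneq uv => /eqP; rewrite subr_eq0 => /eqP[E1 E2].
  by apply/eqP; case: (u) (v) E1 E2 => [u1 u2] [v1 v2] /= E1 E2; congr pair; apply: val_inj.
- rewrite gn_abs /=; case: (u) (v) => [u1 u2] [v1 v2] /=.
  have [] : ((u1 < H.+1) /\ (u2 < H.+1) /\ (v1 < H.+1) /\ (v2 < H.+1))%N by rewrite !ltn_ord.
  move=> a [b [c d]].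
  have A : (`|(u1%:Z - v1%:Z)%R| <= H)%N by lia.
  have B : (`|(u2%:Z - v2%:Z)%R| <= H)%N by lia.
  by rewrite mul2n -addnn leq_add // leq_sqr.
case: fuv => /bin_eq f1 /bin_eq f2.
have -> : beta * gC R (pt u - pt v) = w u - w v by rewrite gCB mulrBr.
move: f1 f2; case: (w u) (w v) => [u1 u2] [v1 v2]; rewrite /csqnorm /= /fr !intrB.
rewrite -exprVn !ler_norml; move: H%:R^-1 => l /andP[a1 a2] /andP[b1 b2].
by nra.
Qed.

End Embedding.

(** * Lattice points in residue classes, and quadratic congruences *)

Section Counting.
Variable R : realType.

Lemma gball_size1 v : (size (gball v) <= (9 * v).+1)%N.
Proof.
case: v => [|v]; last by apply: leq_trans (gball_size _) _.
by apply: (@gball_sqrt 0 0).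
Qed.

Lemma size_cover (T I : eqType) (s : seq T) (sI : seq I) (p : I -> pred T) :
  (forall x, x \in s -> exists2 i, i \in sI & p i x) ->
  (size s <= \sum_(i <- sI) count (p i) s)%N.
Proof.
elim: s => [|x s IH] cov //=; rewrite big_split /= -add1n leq_add //; last first.
  by apply: IH => y ys; apply: cov; rewrite inE ys orbT.
have [|i iI px] := cov x; first exact: mem_head.
by rewrite (big_rem i iI) /= px.
Qed.

(** Without 0 the count has no additive constant, since nothing is left when V < 1. The number of
    nonzero defects is thereby O(W) even for small W. *)
Lemma size_ball_neq0 (s : seq zi) (V : R) : 0 <= V -> uniq s ->
  (forall x, x \in s -> x != 0 /\ (gn x)%:R <= V) -> (size s)%:R <= 9 * V.
Proof.
move=> V0 us sV; have [V1|V1] := leP 1 V; last first.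
  case: s us sV => [|x s] us sV; first by rewrite mulr_ge0.
  have [] := sV x; first exact: mem_head.
  rewrite -gn_gt0 => x0 xV; have : (1 : R) <= (gn x)%:R by rewrite ler1n.
  lra.
have /andP[v1 _] := truncn_itv V0; set v := Num.trunc V in v1.
have v0 : (0 < v)%N by rewrite truncn_ge_nat.
have : (size s <= 9 * v)%N.
  apply: leq_trans (gball_size v0); apply: uniq_leq_size => // x xs.
  by rewrite gball_mem truncn_ge_nat //; case: (sV x xs).
by rewrite -(ler_nat R) natrM; lra.
Qed.

Lemma gn_parallelogram (x y : zi) :
  (gn (x - y) + gn (x + y) = 2 * (gn x + gn y))%N.
Proof.
apply/eqP; rewrite -(eqr_nat int) natrD natrM natrD !natz !gnE /gnorm /=; apply/eqP; ring.
Qed.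

(** By the parallelogram law the two norms add up to at least 2 N(y). *)
Lemma gn_le_sub_or_add (x y : zi) :
  (gn y <= gn (x - y))%N \/ (gn y <= gn (x + y))%N.
Proof.
have := gn_parallelogram x y; move: (gn x) (gn y) (gn (x - y)) (gn (x + y)) => c d a b.
by have [|] := leqP d a; [left | right]; lia.
Qed.

Lemma gnB_le (x y : zi) : (gn (x - y) <= 2 * (gn x + gn y))%N.
Proof. by rewrite -gn_parallelogram leq_addr. Qed.

(** Seen from one member x0, the others are x0 + l k with N(l) N(k) <= 4Y; the ball of such k has at
    most 1 + 9 * 4Y/N(l) points. *)
Lemma size_residue_class (s : seq zi) (l : zi) (Y : R) : 0 <= Y -> uniq s -> l != 0 ->
  (forall x y, x \in s -> y \in s -> zdvd l (x - y)) ->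
  (forall x, x \in s -> (gn x)%:R <= Y) ->
  (size s)%:R <= 1 + 36 * Y / (gn l)%:R.
Proof.
move=> Y0; case: s => [|x0 s] us l0 sl sY.
  by rewrite addr_ge0 // divr_ge0 // mulr_ge0.
have ln : 0 < (gn l)%:R :> R by rewrite ltr0n gn_gt0.
pose V := 4 * Y / (gn l)%:R.
have V0 : 0 <= V by rewrite divr_ge0 // mulr_ge0.
have /andP[v1 _] := truncn_itv V0; set v := Num.trunc V in v1.
have : (size (x0 :: s) <= size [seq (x0 + l * k)%R | k <- gball v])%N.
  apply: uniq_leq_size => // x xs; have x0s := mem_head x0 s.
  have [k kE] := sl x x0 xs x0s; apply/mapP; exists k; last by rewrite -kE subrKC.
  rewrite gball_mem truncn_ge_nat // /V ler_pdivlMr // mulrC -natrM -gnM -kE.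
  have : (gn (x - x0))%:R <= (2 * (gn x + gn x0))%:R :> R by rewrite ler_nat gnB_le.
  by rewrite natrM natrD; have := sY x xs; have := sY x0 x0s; lra.
rewrite size_map => /leq_trans/(_ (gball_size1 v)).
by rewrite -(ler_nat R) -natr1 natrM /V in v1 *; lra.
Qed.

Lemma split_divisor_ex (r d : zi) : exists g : zi, r != 0 -> zdvd d r ->
  exists e d' e', [/\ r = d * e, d = g * d', e = g * e' & zi_cop d' e'].
Proof.
have [->|r0] := eqVneq r 0; first by exists 0.
have [[e rE]|] := pselect (zdvd d r); last by exists 0.
have e0 : e != 0 by apply: contraNneq r0 => e0; rewrite rE e0 mulr0.
have [g [d' [e' [dE eE g0 cop]]]] := zi_gcd d e0.
by exists g => _ _; exists e, d', e'.
Qed.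

(* The gcd of [d] and [r / d]; a junk value unless [d] divides [r != 0]. *)
Definition split_gcd (r d : zi) : zi := sval (cid (split_divisor_ex r d)).

Lemma split_gcdP (r d : zi) : r != 0 -> zdvd d r ->
  exists e d' e', [/\ r = d * e, d = split_gcd r d * d', e = split_gcd r d * e' & zi_cop d' e'].
Proof. by rewrite /split_gcd; case: cid. Qed.

Definition zdvdb (d m : zi) : bool := `[< zdvd d m >].

Lemma size_quadratic (s : seq zi) (r h : zi) (Y : R) : 0 <= Y -> uniq s -> r != 0 ->
  (forall t, t \in s -> zdvd r (t * (t + h)) /\ (gn t)%:R <= Y) ->
  (size s)%:R <= \sum_(d <- gdivs r)
    (1 + 36 * Y / (gn r)%:R * ((zdvdb (split_gcd r d) h)%:R * (gn (split_gcd r d))%:R)).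
Proof.
move=> Y0 us r0 sP.
pose p (d t : zi) := `[< exists2 e, r = d * e & zdvd d t /\ zdvd e (t + h) >].
have cov t : t \in s -> exists2 d, d \in gdivs r & p d t.
  (* The divisor attached to [t] is g = gcd(t, r): cancelling it from r | t(t + h) leaves r' | t'(t
     + h), with t' coprime to r'. *)
  move=> /sP[[k tk] _]; have [g [t' [r' [tE rE g0 cop]]]] := zi_gcd t r0.
  exists g; first by apply/gdivsP => //; exists r'.
  apply/asboolP; exists r' => //; split; first by exists t'.
  apply: (gauss_dvd (zi_copC cop)); exists k; apply: (zi_mulfI g0) => /=.
  by rewrite !mulrA -tE -rE.
have : (size s)%:R <= (\sum_(d <- gdivs r) count (p d) s)%:R :> R.
  by rewrite ler_nat size_cover.
rewrite natr_sum => /le_trans; apply.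
rewrite big_seq [leRHS]big_seq; apply: ler_sum => d /(gdivsP _ r0) dr.
have [e [d' [e' [rE dE eE cop]]]] := split_gcdP r0 dr.
move: dE eE; set g := split_gcd r d => dE eE.
have d0 : d != 0 by apply: contraNneq r0 => d0; rewrite rE d0 mul0r.
have e0 : e != 0 by apply: contraNneq r0 => e0; rewrite rE e0 mulr0.
have g0 : g != 0 by apply: contraNneq d0 => g0; rewrite dE g0 mul0r.
have d'0 : d' != 0 by apply: contraNneq d0 => d'0; rewrite dE d'0 mulr0.
have e'0 : e' != 0 by apply: contraNneq e0 => e'0; rewrite eE e'0 mulr0.
have pE t : p d t -> zdvd d t /\ zdvd e (t + h).
  move=> /asboolP[e1 re1]; suff -> : e1 = e by [].
  by apply: (zi_mulfI d0); rewrite /= -re1.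
have A0 : 0 <= 36 * Y / (gn r)%:R by rewrite divr_ge0 // mulr_ge0.
rewrite -size_filter; case E : [seq t <- s | p d t] => [|t0 u].
  by rewrite addr_ge0 // mulr_ge0 // mulr_ge0.
have t0f : t0 \in [seq t <- s | p d t] by rewrite E mem_head.
rewrite -E {E u}; move: (t0f); rewrite mem_filter => /andP[/pE[dt0 et0] _].
have gh : zdvd g h.
  have -> : h = (t0 + h) - t0 by rewrite addrC addKr.
  by apply: zdvdB; [apply: zdvd_trans et0; exists e' | apply: zdvd_trans dt0; exists d'].
have -> : zdvdb g h = true by apply/asboolP.
(* The lcm of [d] and [e]: members of the class agree modulo both, hence modulo [l], and N(r) = N(g)
   N(l). *)
pose l := d' * e; have l0 : l != 0 by rewrite zi_mulf_eq0 negb_or d'0.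
have lr : (gn r)%:R = (gn g)%:R * (gn l)%:R :> R.
  by rewrite -natrM -gnM /l mulrA -dE -rE.
have -> : 36 * Y / (gn r)%:R * (true%:R * (gn g)%:R) = 36 * Y / (gn l)%:R.
  by rewrite lr [true%:R * _]mul1r; field; rewrite !pnatr_eq0 !gn_eq0 g0 l0.
apply: size_residue_class => //; first exact: filter_uniq.
  move=> x y; rewrite !mem_filter => /andP[/pE[dx ex] _] /andP[/pE[dy ey] _].
  have [u uE] := zdvdB dx dy.
  have [v] : zdvd e (x - y).
    by have := zdvdB ex ey; rewrite opprD addrACA subrr addr0.
  rewrite uE {1}dE {1}eE -!mulrA => /(zi_mulfI g0) uv.
  have [k kE] : zdvd e' u by apply: (gauss_dvd (zi_copC cop)); exists v.
  by exists k; rewrite kE /l {1}dE eE; ring.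
by move=> x; rewrite mem_filter => /andP[_ /sP[]].
Qed.

Lemma exists_max_gn (s : seq zi) : s != [::] ->
  exists2 x, x \in s & forall y, y \in s -> (gn y <= gn x)%N.
Proof.
elim: s => // x [|x1 s] IH _.
  by exists x; rewrite ?mem_head // => y; rewrite inE => /eqP ->.
have [//|z zs zmax] := IH; have [xz|zx] := leqP (gn x) (gn z).
  exists z; first by rewrite inE zs orbT.
  by move=> y; rewrite inE => /predU1P[->|/zmax].
exists x; rewrite ?mem_head // => y; rewrite inE => /predU1P[->//|/zmax yz].
exact: leq_trans yz (ltnW zx).
Qed.

(* Among the q with b q^2 = - m mod r, any two satisfy (q - q0)(q + q0) = 0 mod r;
   taking q0 of maximal norm makes one of the two factors small. *)
Lemma size_square_class (s : seq zi) (q0 r : zi) (Y : R) : 0 <= Y -> uniq s -> r != 0 ->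
  (forall q, q \in s -> zdvd r ((q - q0) * (q + q0))) ->
  (forall q, q \in s -> (gn (q - q0))%:R <= Y \/ (gn (q + q0))%:R <= Y) ->
  (size s)%:R <= 2 * \sum_(d <- gdivs r) (1 + 36 * Y / (gn r)%:R *
    ((zdvdb (split_gcd r d) (2 * q0))%:R * (gn (split_gcd r d))%:R)).
Proof.
move=> Y0 us r0 sr sY; pose p (e q : zi) := (gn (q + e))%:R <= Y.
pose T e := [seq q + e | q <- s & p e q].
have szT : (size s <= size (T (- q0)) + size (T q0))%N.
  rewrite !size_map !size_filter -count_predUI; apply: leq_trans (leq_addr _ _).
  rewrite -size_filter; apply: eq_leq; rewrite size_filter; apply/esym/eqP.
  by rewrite -all_count; apply/allP => q /sY[H|H]; rewrite /= /p H ?orbT.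
have TP e : e = q0 \/ e = - q0 -> (size (T e))%:R <= \sum_(d <- gdivs r)
    (1 + 36 * Y / (gn r)%:R *
    ((zdvdb (split_gcd r d) (2 * q0))%:R * (gn (split_gcd r d))%:R)).
  (* For t = q + e the congruence t(t + h) = 0 with h = -2e is (q + e)(q - e) = 0; the sign of e
     does not affect which g divide h. *)
  move=> eE; have -> : \sum_(d <- gdivs r) (1 + 36 * Y / (gn r)%:R *
      ((zdvdb (split_gcd r d) (2 * q0))%:R * (gn (split_gcd r d))%:R)) =
    \sum_(d <- gdivs r) (1 + 36 * Y / (gn r)%:R *
      ((zdvdb (split_gcd r d) (- (2 * e)))%:R * (gn (split_gcd r d))%:R)).
    apply: eq_bigr => d _; congr (_ + _ * ((_ : bool)%:R * _)).
    case: eE => ->; last by rewrite mulrN opprK.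
    by apply/asboolP/asboolP => /zdvdN //; rewrite opprK.
  apply: size_quadratic => //.
    by rewrite map_inj_uniq ?filter_uniq //; exact: addIr.
  move=> t /mapP[q]; rewrite mem_filter => /andP[pq qs] ->; split => //.
  have := sr q qs; case: eE => ->; first by congr zdvd; ring.
  by congr zdvd; ring.
have := TP _ (or_introl erefl); have := TP _ (or_intror erefl).
move: szT; rewrite -(ler_nat R) natrD; lra.
Qed.
End Counting.

(** * Fractions with square denominator near a fixed point *)

Section SquareModuli.
Variables (R : realType) (beta : R[i]) (r b : zi) (N Q : nat).
Hypotheses (r0 : r != 0) (cop_rb : zi_cop r b) (N0 : (0 < N)%N).

Definition defect (x : zi * zi) : zi := x.2 * r - b * (x.1 * x.1).

Definition near_square_fraction (x : zi * zi) := [/\ x.1 != 0, (gn x.1 <= Q)%N, zi_cop x.2 x.1 &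
  csqnorm (gC R x.2 / (gC R x.1 * gC R x.1) - beta) <= N%:R^-1].

Let z : R[i] := beta - gC R b / gC R r.
(** Dominates both |z|^2 and |theta|^2, where a/q^2 - b/r = z + theta. *)
Let D : R := Num.max (csqnorm z) N%:R^-1.
Let theta (x : zi * zi) : R[i] := gC R x.2 / (gC R x.1 * gC R x.1) - beta.

Lemma defect_eq x : x.1 != 0 ->
  gC R (defect x) = gC R r * (gC R (x.1 * x.1) * (z + theta x)).
Proof.
move=> x0; rewrite /defect gCB !gCM /z /theta; field.
by rewrite !gC_eq0 r0 x0.
Qed.

Let Ngt0 : 0 < N%:R^-1 :> R.
Proof. by rewrite invr_gt0 ltr0n. Qed.

Let DN : N%:R^-1 <= D.
Proof. by rewrite /D le_max lexx orbT. Qed.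

Let Dgt0 : 0 < D.
Proof. exact: lt_le_trans Ngt0 DN. Qed.

Let Dz : csqnorm z <= D.
Proof. by rewrite /D le_max lexx. Qed.

(** [Y] will bound the smaller of N(q - q0) and N(q + q0), [W] the norm of the defect; their product
    is free of [D]. *)
Let Y : R := 4 * Q%:R / (N%:R * D).
Let W : R := 4 * (gn r)%:R * Q%:R ^+ 2 * D.

Let Y0 : 0 <= Y.
Proof. by rewrite /Y divr_ge0 ?mulr_ge0 // ltW. Qed.

Let W0 : 0 <= W.
Proof. by rewrite /W !mulr_ge0 // ltW. Qed.

Lemma gn_defect_le x : near_square_fraction x -> (gn (defect x))%:R <= W.
Proof.
move=> [x0 xQ _ xb]; rewrite -csqnorm_gC defect_eq // !csqnormM !csqnorm_gC gnM natrM.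
have q2 : (gn x.1)%:R * (gn x.1)%:R <= Q%:R ^+ 2 :> R.
  by rewrite -natrM -natrX ler_nat expnS expn1 leq_mul.
have zt : csqnorm (z + theta x) <= 4 * D.
  by apply: le_trans (csqnormD_le _ _) _; rewrite /theta; have := DN; have := Dz; lra.
have -> : W = (gn r)%:R * (Q%:R ^+ 2 * (4 * D)) by rewrite /W; ring.
by rewrite ler_wpM2l // ler_pM ?csqnorm_ge0 ?mulr_ge0.
Qed.

(** Write q, q0 for the denominators of [x], [y]. Equal defects give (q^2 - q0^2) z = q0^2 theta_y -
    q^2 theta_x, so N(q - q0) N(q + q0) |z|^2 <= 4 N(q0)^2/N. One factor is at least N(q0), which
    bounds the other. *)
Lemma near_or_opposite x y : near_square_fraction x -> near_square_fraction y ->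
  (gn x.1 <= gn y.1)%N -> defect x = defect y ->
  (gn (x.1 - y.1))%:R <= Y \/ (gn (x.1 + y.1))%:R <= Y.
Proof.
move=> [x0 xQ _ xb] [y0 yQ _ yb] xy dxy.
have Nn : 0 < N%:R :> R by rewrite ltr0n.
have yR0 : 0 < (gn y.1)%:R :> R by rewrite ltr0n gn_gt0.
have xyR : (gn x.1)%:R <= (gn y.1)%:R :> R by rewrite ler_nat.
have yQR : (gn y.1)%:R <= Q%:R :> R by rewrite ler_nat.
(* If |z|^2 < 1/N then Y = 4Q, and the bound is trivial. *)
have [Nz|zN] := leP N%:R^-1 (csqnorm z); last first.
  left; have -> : Y = 4 * Q%:R.
    by rewrite /Y /D max_r ?(ltW zN) // divff ?gt_eqF // divr1.
  have : (gn (x.1 - y.1))%:R <= (2 * (gn x.1 + gn y.1))%:R :> R by rewrite ler_nat gnB_le.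
  by rewrite natrM natrD; lra.
have DE : D = csqnorm z by rewrite /D max_l.
set A := gn (x.1 - y.1); set B := gn (x.1 + y.1).
have AB : A%:R * B%:R * D <= 4 * (gn y.1)%:R ^+ 2 / N%:R.
  rewrite -natrM -gnM DE -csqnorm_gC -csqnormM.
  have -> : gC R ((x.1 - y.1) * (x.1 + y.1)) * z =
      gC R (y.1 * y.1) * theta y - gC R (x.1 * x.1) * theta x.
    have : gC R (x.1 * x.1) * (z + theta x) = gC R (y.1 * y.1) * (z + theta y).
      have rC : gC R r != 0 by rewrite gC_eq0.
      by apply: (mulfI rC); rewrite -!defect_eq // dxy.
    have -> : (x.1 - y.1) * (x.1 + y.1) = x.1 * x.1 - y.1 * y.1 by ring.
    by rewrite gCB !mulrDr mulrBl => /eqP; rewrite -subr_eq0 => /eqP E;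
      apply/eqP; rewrite -subr_eq0 -E; apply/eqP; ring.
  apply: le_trans (csqnormB_le _ _) _; rewrite !csqnormM !csqnorm_gC !gnM !natrM.
  have := ler_pM (sqr_ge0 ((gn y.1)%:R : R)) (csqnorm_ge0 _) (lexx _) yb.
  have xx : (gn x.1)%:R ^+ 2 <= (gn y.1)%:R ^+ 2 :> R by rewrite lerXn2r ?nnegrE.
  have := ler_pM (sqr_ge0 ((gn x.1)%:R : R)) (csqnorm_ge0 _) xx xb.
  rewrite /theta !expr2; lra.
have S : (gn y.1 <= A)%N \/ (gn y.1 <= B)%N := gn_le_sub_or_add x.1 y.1.
have ND : 0 < N%:R * D by rewrite mulr_gt0.
have bound (u v : nat) : u%:R * v%:R * D <= 4 * (gn y.1)%:R ^+ 2 / N%:R ->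
    (gn y.1 <= u)%N -> v%:R <= Y.
  rewrite -(ler_nat R) => uv yu; rewrite /Y ler_pdivlMr //.
  apply: (@le_trans _ _ (4 * (gn y.1)%:R)); last lra.
  rewrite -(ler_pM2l yR0); apply: (@le_trans _ _ (u%:R * (v%:R * (N%:R * D)))).
    by rewrite ler_wpM2r // mulr_ge0 // ltW.
  move: uv; rewrite ler_pdivlMr //; lra.
case: S => [yA|yB]; first by right; apply: bound AB yA.
by left; apply: (bound B) yB; rewrite mulrC [B%:R * _]mulrC -mulrC.
Qed.

(** From a r = b q^2 with [a] coprime to q follows q^2 | r, and q determines [a]. *)
Lemma size_defect0 (P : seq (zi * zi)) : uniq P ->
  (forall x, x \in P -> near_square_fraction x /\ defect x = 0) ->
  (size P <= size (gdivs r))%N.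
Proof.
move=> uP hP; rewrite -(size_map fst); apply: uniq_leq_size.
  rewrite map_inj_in_uniq // => -[q a] [q' a'] /hP[_ /= d1] /hP[_ /= d2] /= qq.
  rewrite -qq in d2 *; congr pair; apply: (zi_mulfI r0) => /=.
  move: d1 d2; rewrite /defect /= => /eqP; rewrite subr_eq0 => /eqP d1 /eqP.
  by rewrite subr_eq0 => /eqP d2; rewrite mulrC d1 -d2 mulrC.
move=> q /mapP[x /hP[[x0 _ cop _]] + ->]; rewrite /defect => /eqP; rewrite subr_eq0 => /eqP d.
apply/gdivsP => //; have /zi_copC/gauss_dvd := zi_cop_sq cop.
move=> /(_ r); rewrite d => H; apply: zdvd_trans (H _); first by exists x.1.
exact/zdvd_mull/zdvd_refl.
Qed.

(** The condition g | 2 q0 is weakened to g^2 | 4m, which no longer involves the pivot q0 and can be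
    summed over [m]. *)
Lemma size_defect (P : seq (zi * zi)) (m : zi) : uniq P ->
  (forall x, x \in P -> near_square_fraction x /\ defect x = m) ->
  (size P)%:R <= 2 * \sum_(d <- gdivs r) (1 + 36 * Y / (gn r)%:R *
    ((zdvdb (split_gcd r d * split_gcd r d) (4 * m))%:R * (gn (split_gcd r d))%:R)).
Proof.
move=> uP hP; have g0 : 0 <= 36 * Y / (gn r)%:R by rewrite divr_ge0 // mulr_ge0.
have [->|P0] := eqVneq P [::].
  by rewrite mulr_ge0 // sumr_ge0 // => d _; rewrite addr_ge0 // mulr_ge0 // mulr_ge0.
pose s := map fst P.
have us : uniq s.
  rewrite map_inj_in_uniq // => -[q a] [q' a'] /hP[_ /= d1] /hP[_ /= d2] /= qq.
  rewrite -qq in d2 *; congr pair; apply: (zi_mulfI r0) => /=.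
  by rewrite mulrC -[a * r](subrK (b * (q * q))) -[_ - _]/(defect (q, a)) d1 -d2 subrK mulrC.
have s0 : s != [::] by rewrite /s; case: (P) P0.
have [q0 /mapP[x0 x0P ->] qmax] := exists_max_gn s0.
have [nx0 dx0] := hP x0 x0P.
rewrite -(size_map fst).
apply: le_trans (size_square_class Y0 us r0 (q0 := x0.1) _ _) _.
- move=> q /mapP[x xP ->]; have [_ dx] := hP x xP.
  (* Equal defects give b (q^2 - q0^2) = (a - a0) r, and [b] is coprime to [r]. *)
  apply: (gauss_dvd cop_rb); exists (x.2 - x0.2).
  have : defect x = defect x0 by rewrite dx dx0.
  rewrite /defect => /eqP; rewrite -subr_eq0 => /eqP E.
  by apply/eqP; rewrite -subr_eq0 -oppr_eq0 -E; apply/eqP; ring.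
- move=> q /mapP[x xP ->]; have [nx dx] := hP x xP.
  by apply: near_or_opposite; rewrite ?dx ?dx0 //; apply/qmax/map_f.
rewrite ler_wpM2l //; rewrite big_seq [leRHS]big_seq; apply: ler_sum => d /(gdivsP _ r0) dr.
rewrite lerD2l ler_wpM2l // ler_wpM2r //; rewrite {1}/zdvdb.
case: asboolP => [[k kE]|_]; last exact: ler0n.
suff -> : zdvdb (split_gcd r d * split_gcd r d) (4 * m) = true by [].
apply/asboolP; have [e [d' [e' [rE dE eE _]]]] := split_gcdP r0 dr.
move: dE eE kE; set g := split_gcd r d => dE eE kE.
have -> : 4 * m = 4 * x0.2 * r - b * ((2 * x0.1) * (2 * x0.1)).
  by rewrite -dx0 /defect; ring.
exists (4 * x0.2 * d' * e' - b * k * k); rewrite kE rE {1}dE eE; ring.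
Qed.

(** Writing 4m = g^2 k, the nonzero k have norm at most 16W/N(g)^2, so there are at most 144W/N(g)^2
    of them: more than enough to absorb the factor N(g). *)
Lemma sum_zdvd_le (s : seq zi) (g : zi) : g != 0 -> uniq s ->
  (forall m, m \in s -> m != 0 /\ (gn m)%:R <= W) ->
  \sum_(m <- s) (zdvdb (g * g) (4 * m))%:R * (gn g)%:R <= 144 * W.
Proof.
move=> g0 us hs; rewrite -mulr_suml sum_count -size_filter.
set t := [seq m <- s | _].
have gg0 : g * g != 0 by rewrite zi_mulf_eq0 negb_or g0.
have gp : 0 < (gn g)%:R :> R by rewrite ltr0n gn_gt0.
have g1 : 1 <= (gn g)%:R :> R by rewrite ler1n gn_gt0.
have kex (m : zi) : exists k : zi, zdvd (g * g) (4 * m) -> 4 * m = g * g * k.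
  by have [[k kE]|] := pselect (zdvd (g * g) (4 * m)); [exists k | exists 0].
pose k m := sval (cid (kex m)).
have kE m : m \in t -> 4 * m = g * g * k m.
  by rewrite mem_filter => /andP[/asboolP gm _]; rewrite /k; case: cid => /= k' /(_ gm).
have four0 : (4 : zi) != 0 by [].
have gk m : m \in t -> (gn g)%:R ^+ 2 * (gn (k m))%:R = 16 * (gn m)%:R :> R.
  move=> /kE /(congr1 gn); rewrite !gnM => /(congr1 (fun n : nat => n%:R : R)).
  by rewrite !natrM -[gn 4]/16%N => ->; ring.
have -> : size t = size (map k t) by rewrite size_map.
have ukt : uniq (map k t).
  rewrite map_inj_in_uniq ?filter_uniq // => m m' mt m't kk.
  by apply: (zi_mulfI four0) => /=; rewrite !kE // kk.
have V0 : 0 <= 16 * W / (gn g)%:R ^+ 2.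
  by apply: divr_ge0; [apply: mulr_ge0 | apply: sqr_ge0].
have := @size_ball_neq0 R (map k t) (16 * W / (gn g)%:R ^+ 2) V0 ukt.
move=> /(_ _)/le_trans => H.
have {}H : (size (map k t))%:R <= 9 * (16 * W / (gn g)%:R ^+ 2).
  apply: (H _ _ (lexx _)) => _ /mapP[m mt ->].
  have [m0 mW] : m != 0 /\ (gn m)%:R <= W.
    by apply: hs; move: mt; rewrite mem_filter => /andP[].
  split.
    apply: contraNneq m0 => k0; move: (kE m mt); rewrite k0 mulr0 => /eqP.
    by rewrite zi_mulf_eq0 (negbTE four0).
  by rewrite ler_pdivlMr ?exprn_gt0 // mulrC gk // ler_wpM2l.
apply: le_trans (ler_wpM2r (ltW gp) H) _.
have -> : 9 * (16 * W / (gn g)%:R ^+ 2) * (gn g)%:R = 144 * W / (gn g)%:R.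
  by field; rewrite gt_eqF.
by rewrite ler_pdivrMr // ler_peMr // mulr_ge0.
Qed.

(** Per divisor of [r]: 1 for defect 0; for the other defects 2 * 9W from the constant terms, and 2
    * 144 * 36 YW/N(r) from the spread, where YW/N(r) = 16 Q^3/N. *)
Lemma count_near_square_fraction (P : seq (zi * zi)) : uniq P ->
  (forall x, x \in P -> near_square_fraction x) ->
  (size P)%:R <= (size (gdivs r))%:R *
    (1 + 18 * W + 288 * 36 * (16 * Q%:R ^+ 3 / N%:R)).
Proof.
move=> uP hP; pose T : R := (size (gdivs r))%:R; rewrite -/T.
pose P0 := [seq x <- P | defect x == 0].
pose P1 := [seq x <- P | defect x != 0].
have -> : size P = (size P0 + size P1)%N by rewrite !size_filter count_predC.
have h0 : (size P0)%:R <= T.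
  rewrite ler_nat; apply: size_defect0; first exact: filter_uniq.
  by move=> x; rewrite mem_filter => /andP[/eqP d0 /hP].
pose ms := [seq m <- gball (Num.trunc W) | (m : zi) != 0].
have msP (m : zi) : m \in ms -> m != 0 /\ (gn m)%:R <= W.
  by rewrite mem_filter gball_mem truncn_ge_nat // => /andP.
have ums : uniq ms by apply/filter_uniq/gball_uniq.
pose A : R := 36 * Y / (gn r)%:R.
have A0 : 0 <= A by rewrite divr_ge0 // mulr_ge0.
pose F (d m : zi) : R :=
  (zdvdb (split_gcd r d * split_gcd r d) (4 * m))%:R * (gn (split_gcd r d))%:R.
have h1 : (size P1)%:R <= \sum_(m <- ms) 2 * \sum_(d <- gdivs r) (1 + A * F d m).
  have : (size P1 <= \sum_(m <- ms) count (fun x => defect x == m) P1)%N.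
    apply: (@size_cover _ zi) => x; rewrite mem_filter => /andP[d0 xP].
    exists (defect x); last exact: eqxx.
    by rewrite mem_filter d0 gball_mem truncn_ge_nat // gn_defect_le //; apply: hP.
  rewrite -(ler_nat R) natr_sum => /le_trans; apply.
  apply: ler_sum => m _; rewrite -size_filter; apply: size_defect.
    exact/filter_uniq/filter_uniq.
  by move=> x; rewrite !mem_filter => /andP[/eqP dm /andP[_ /hP]].
have h2 : \sum_(m <- ms) 2 * \sum_(d <- gdivs r) (1 + A * F d m) <=
    2 * (T * (9 * W + A * (144 * W))).
  rewrite -mulr_sumr ler_wpM2l // exchange_big /=.
  apply: (@le_trans _ _ (\sum_(d <- gdivs r) (9 * W + A * (144 * W)))); last first.
    by rewrite big_const_seq count_predT iter_addr addr0 -[leLHS]mulr_natl.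
  rewrite big_seq [leRHS]big_seq; apply: ler_sum => d /(gdivsP _ r0) dr.
  have [e [d' [e' [rE dE _ _]]]] := split_gcdP r0 dr.
  have g0 : split_gcd r d != 0.
    by apply: contraNneq r0 => g0; rewrite rE dE g0 !mul0r.
  rewrite big_split /= -mulr_sumr lerD //; last first.
    by rewrite ler_wpM2l //; apply: sum_zdvd_le.
  rewrite big_const_seq count_predT iter_addr addr0.
  exact: size_ball_neq0.
have nr0 : (gn r)%:R != 0 :> R by rewrite pnatr_eq0 gn_eq0.
have YW : A * W = 36 * (16 * Q%:R ^+ 3 / N%:R).
  have Nn0 : N%:R != 0 :> R by rewrite pnatr_eq0 -lt0n.
  have Dn0 : D != 0 by rewrite gt_eqF.
  by rewrite /A /Y /W; field; rewrite ?nr0 ?Nn0 ?Dn0.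
rewrite natrD.
have -> : T * (1 + 18 * W + 288 * 36 * (16 * Q%:R ^+ 3 / N%:R)) =
   T + 2 * (T * (9 * W + 144 * (36 * (16 * Q%:R ^+ 3 / N%:R)))) by ring.
rewrite -YW; have -> : 144 * (A * W) = A * (144 * W) by ring.
by rewrite lerD // (le_trans h1).
Qed.

(** N(r) D is either |beta r - b|^2 or N(r)/N <= 2H^2/N; as H^4 <= N both are at most 2/H^2, and
    sqrt N <= (H + 1)^2 <= 4H^2. *)
Lemma defect_bound_le (H : nat) : (0 < H)%N -> (gn r <= 2 * H ^ 2)%N -> (H ^ 4 <= N)%N ->
  (N < H.+1 ^ 4)%N -> csqnorm (beta * gC R r - gC R b) <= 2 / H%:R ^+ 2 ->
  W <= 32 * (Q%:R ^+ 2 / Num.sqrt N%:R).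
Proof.
move=> H0 rH HN NH bH.
have HR : 0 < H%:R :> R by rewrite ltr0n.
have sN : 0 < Num.sqrt N%:R :> R by rewrite sqrtr_gt0 ltr0n.
have nrp : 0 < (gn r)%:R :> R by rewrite ltr0n gn_gt0.
have rD : (gn r)%:R * D <= 2 / H%:R ^+ 2.
  rewrite /D; case: (leP (csqnorm z)) => _; last first.
    rewrite -csqnorm_gC -csqnormM; suff -> : gC R r * z = beta * gC R r - gC R b by [].
    by rewrite /z; field; rewrite gC_eq0.
  rewrite ler_pdivlMr ?exprn_gt0 // mulrAC ler_pdivrMr ?ltr0n //.
  by rewrite -natrX -!natrM ler_nat; nia.
have sH : Num.sqrt N%:R <= 4 * H%:R ^+ 2 :> R.
  rewrite -[leRHS]ger0_norm ?mulr_ge0 ?sqr_ge0 // -sqrtr_sqr ler_wsqrtr //.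
  rewrite -natrX -natrM -natrX ler_nat (leq_trans (ltnW NH)) //.
  rewrite (expnM _ 2 2) leq_sqr; nia.
have -> : W = 4 * Q%:R ^+ 2 * ((gn r)%:R * D) by rewrite /W; ring.
have {}sH : 2 / H%:R ^+ 2 <= 8 / Num.sqrt N%:R :> R.
  rewrite ler_pdivrMr ?exprn_gt0 // mulrAC ler_pdivlMr //; lra.
have q0 : 0 <= 4 * Q%:R ^+ 2 :> R by rewrite mulr_ge0 ?sqr_ge0.
by have := ler_wpM2l q0 (le_trans rD sH); lra.
Qed.
End SquareModuli.

(** * The choice of the approximation, and the resulting local density *)

Lemma coprime_dirichlet (R : realType) (beta : R[i]) (H : nat) : (0 < H)%N -> exists r b : zi,
  [/\ r != 0, (gn r <= 2 * H ^ 2)%N, zi_cop r b &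
     csqnorm (beta * gC R r - gC R b) <= 2 / H%:R ^+ 2].
Proof.
move=> H0; have [r [b [r0 rH bH]]] := zi_dirichlet beta H0.
have [g [b' [r' [bE rE g0 cop]]]] := zi_gcd b r0.
have r'0 : r' != 0 by apply: contraNneq r0 => r'0; rewrite rE r'0 mulr0.
have g1 : (0 < gn g)%N by rewrite gn_gt0.
exists r', b'; split=> //; last 2 first.
- exact: zi_copC.
- apply: le_trans bH; have -> : beta * gC R r - gC R b = gC R g * (beta * gC R r' - gC R b').
    by rewrite rE bE !gCM; ring.
  by rewrite csqnormM csqnorm_gC ler_peMl ?csqnorm_ge0 // ler1n.
by apply: leq_trans rH; rewrite rE gnM leq_pmull.
Qed.

Lemma fourth_root (N : nat) : (0 < N)%N ->
  exists2 H, (0 < H)%N & (H ^ 4 <= N < H.+1 ^ 4)%N.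
Proof.
move=> N0; have [k /andP[k1 k2]] := isqrt N; have [H /andP[H1 H2]] := isqrt k.
have k0 : (0 < k)%N by case: (k) k2; lia.
exists H; first by case: (H) H2; lia.
rewrite (expnM H 2 2) (expnM H.+1 2 2); apply/andP; split.
  by apply: leq_trans k1; rewrite leq_sqr.
by apply: leq_trans k2 _; rewrite leq_sqr.
Qed.

Lemma count_near_fractions (R : realType) (eps : R) : 0 < eps ->
  exists2 C : R, 0 < C & forall (Q N : nat) (beta : R[i]) (P : seq (zi * zi)),
    (0 < N)%N -> uniq P -> (forall x, x \in P -> near_square_fraction beta N Q x) ->
    (size P)%:R <= C * N%:R `^ eps *
      (1 + Q%:R ^+ 2 / Num.sqrt N%:R + Q%:R ^+ 3 / N%:R).
Proof.
move=> eps0; have [C C0 divC] := divisor_bound eps0.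
have two0 : 0 < 2 `^ eps :> R by rewrite powR_gt0.
(* 2^eps comes from N(r) <= 2H^2 <= 2N; 408^2 exceeds both 288 * 36 * 16 and 18 * 32. *)
exists (C * 2 `^ eps * (408 * 408)); first by rewrite !mulr_gt0.
move=> Q N beta P N0 uP hP; have [H H0 /andP[HN NH]] := fourth_root N0.
have [r [b [r0 rH cop bH]]] := coprime_dirichlet beta H0.
have cnt := count_near_square_fraction r0 cop N0 uP hP.
have Wle := defect_bound_le Q r0 N0 H0 rH HN NH bH.
have T_le : (size (gdivs r))%:R <= C * (2 `^ eps * N%:R `^ eps).
  apply: le_trans (divC r r0) _; rewrite ler_wpM2l ?(ltW C0) // -powRM //.
  apply: ge0_ler_powR; rewrite ?nnegrE ?mulr_ge0 ?(ltW eps0) // -natrM ler_nat.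
  by apply: leq_trans rH _; rewrite leq_mul2l /=; apply: leq_trans HN; rewrite leq_pexp2l.
have A0 : 0 <= Q%:R ^+ 2 / Num.sqrt N%:R :> R by rewrite divr_ge0 ?sqr_ge0 ?sqrtr_ge0.
have B0 : 0 <= Q%:R ^+ 3 / N%:R :> R by rewrite divr_ge0 // exprn_ge0.
have T0 : 0 <= (size (gdivs r))%:R :> R by [].
apply: le_trans cnt _; apply: (@le_trans _ _ ((size (gdivs r))%:R *
  (408 * 408 * (1 + Q%:R ^+ 2 / Num.sqrt N%:R + Q%:R ^+ 3 / N%:R)))).
  by rewrite ler_wpM2l //; lra.
set B := 1 + _ + _; have {}B0 : 0 <= B by rewrite /B; lra.
have -> : C * 2 `^ eps * (408 * 408) * N%:R `^ eps * B =
  C * (2 `^ eps * N%:R `^ eps) * (408 * 408 * B) by ring.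
by rewrite ler_wpM2r // !mulr_ge0.
Qed.

(** * From arbitrary residue systems to the final inequality *)

Lemma residue_system_uniq (S : seq gint) (m : gint) : complete_residue_system S m ->
  uniq S /\ forall a a' : zi, a \in S -> a' \in S -> zdvd m (a - a') -> a = a'.
Proof.
move=> [_ inj]; split.
  apply/(uniqP (0, 0)) => i j; rewrite !inE => iS jS E; apply: inj => //.
  by rewrite E; exists (0 : zi); apply: zi_eq; rewrite /= subrr ?mulr0 ?mul0r ?addr0 ?subr0.
move=> a a' aS a'S aa'.
have E : index a S = index a' S.
  by apply: inj; rewrite ?index_mem // !nth_index.
by rewrite -(nth_index (0, 0) aS) E nth_index.
Qed.

Definition fraction (R : realType) (x : gint * gint) : R[i] :=
  gC R x.2 / (gC R x.1 * gC R x.1).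

Definition reduced_fractions (res : gint -> seq gint) (Q : nat) : seq (gint * gint) :=
  [seq (q, a) | q <- [seq q <- gball Q | q != (0, 0)],
                a <- [seq a <- res q | `[< gcoprime a q >]]].

Section ReducedFractions.
Variables (R : realType) (res : gint -> seq gint) (Q N : nat).
Hypothesis resP : forall q : gint, q != (0, 0) ->
  complete_residue_system (res q) (gmul q q).

Lemma reduced_fractionsP x : x \in reduced_fractions res Q ->
  [/\ x.1 != (0, 0), x.1 \in gball Q, x.2 \in res x.1 & gcoprime x.2 x.1].
Proof.
move=> /allpairsPdep[q [a [+ + ->]]]; rewrite !mem_filter.
by move=> /andP[q0 qQ] /andP[/asboolP cop ar].
Qed.

Lemma reduced_fractions_uniq : uniq (reduced_fractions res Q).
Proof.
apply: allpairs_uniq_dep; first exact/filter_uniq/gball_uniq.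
  move=> q; rewrite mem_filter => /andP[/resP/residue_system_uniq[uq _] _].
  exact: filter_uniq.
by move=> [q a] [q' a'] _ _ /= [-> ->].
Qed.

(* The representatives in [res q] are arbitrary, so the shift [k] is absorbed by replacing
   [a] with [a + k q^2]. *)
Lemma count_reduced_fractions (beta : R[i]) (K : R) :
  (forall P : seq (zi * zi), uniq P ->
     (forall x, x \in P -> near_square_fraction beta N Q x) -> (size P)%:R <= K) ->
  (count (fun x => `[< exists k : zi,
     csqnorm (fraction R x + gC R k - beta) <= N%:R^-1 >])
     (reduced_fractions res Q))%:R <= K.
Proof.
move=> hK; rewrite -size_filter; set s := [seq x <- _ | _].
have kex (x : gint * gint) : exists k : zi, x \in s ->
    csqnorm (fraction R x + gC R k - beta) <= N%:R^-1.
  have [|] := boolP (x \in s); last by exists 0.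
  by rewrite mem_filter => /andP[/asboolP[k hk] _]; exists k.
pose k x := sval (cid (kex x)).
have kP x : x \in s -> csqnorm (fraction R x + gC R (k x) - beta) <= N%:R^-1.
  by rewrite /k; case: cid.
pose phi (x : gint * gint) : zi * zi :=
  ((x.1 : zi), (x.2 : zi) + k x * ((x.1 : zi) * (x.1 : zi))).
have sP x : x \in s -> [/\ x.1 != (0, 0), x.1 \in gball Q, x.2 \in res x.1 & gcoprime x.2 x.1].
  by rewrite mem_filter => /andP[_ /reduced_fractionsP].
rewrite -(size_map phi); apply: hK.
  rewrite map_inj_in_uniq; first exact/filter_uniq/reduced_fractions_uniq.
  move=> [q a] [q' a'] /[dup] xs /sP[/= q0 _ ar _] /[dup] xs' /sP[/= _ _ ar' _].
  pose u := k (q, a); pose v := k (q', a') => /[dup] /(congr1 fst) /= qq /(congr1 snd) E0.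
  have {E0}E : (a : zi) + u * ((q : zi) * q) = (a' : zi) + v * ((q' : zi) * q') := E0.
  rewrite -{}qq in ar' E *.
  suff -> : a = a' by [].
  have [_ H] := residue_system_uniq (resP q0).
  apply: H => //; exists (v - u).
  have aE : (a : zi) = (a' : zi) + v * ((q : zi) * q) - u * ((q : zi) * q).
    by rewrite -E addrK.
  by rewrite aE -[gmul q q]/((q : zi) * (q : zi)); ring.
move=> _ /mapP[x xs ->]; have [q0 qQ _ cop] := sP x xs.
split => //=; first by rewrite -gball_mem.
  have [u [v uv]] := gcoprime_cop cop.
  by exists u, (v - u * k x * x.1); rewrite -[RHS]uv; ring.
apply: le_trans (kP x xs); rewrite /fraction le_eqVlt; apply/orP; left; apply/eqP.
congr csqnorm; rewrite gCD !gCM; field.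
by rewrite gC_eq0.
Qed.

End ReducedFractions.

Local Close Scope complex_scope.
Unset Implicit Arguments.
Set Strict Implicit.

Theorem theorem3 (R : realType) :
  forall eps : R, 0 < eps ->
  exists C : R, 0 < C /\
  forall (Q N : nat), (1 <= Q)%N -> (1 <= N)%N ->
  forall (c : gint -> R[i]) (res : gint -> seq gint),
    (forall q : gint, q != (0, 0) ->
       complete_residue_system (res q) (gmul q q)) ->
    \sum_(q <- gball Q | q != (0, 0))
      \sum_(a <- res q | `[< gcoprime a q >])
        csqnorm (expsum N c q a)
    <= C * ((Q%:R * N%:R) `^ eps)
         * ((Q%:R) ^+ 3 + (Q%:R) ^+ 2 * Num.sqrt (N%:R) + N%:R)
         * (\sum_(n <- gball N) csqnorm (c n)).
Proof.
move=> eps eps0; have [C C0 countC] := count_near_fractions eps0.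
exists (1350 * 1350 * C); split; first by rewrite !mulr_gt0.
move=> Q N Q0 N0 c res resP.
have Np : 0 < N%:R :> R by rewrite ltr0n.
have sp : 0 < Num.sqrt N%:R :> R by rewrite sqrtr_gt0.
pose B : R := 1 + Q%:R ^+ 2 / Num.sqrt N%:R + Q%:R ^+ 3 / N%:R.
have B0 : 0 < B.
  rewrite /B; have : 0 <= Q%:R ^+ 2 / Num.sqrt N%:R :> R by rewrite divr_ge0 ?sqr_ge0 ?sqrtr_ge0.
  have : 0 <= Q%:R ^+ 3 / N%:R :> R by rewrite divr_ge0 // exprn_ge0.
  lra.
pose K := C * N%:R `^ eps * B.
have K0 : 0 < K by rewrite !mulr_gt0 // powR_gt0.
have [M MN] := isqrt N.
have := large_sieve (sJ := reduced_fractions res Q) (alpha := fraction R) K0 MN N0.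
move=> /(_ (fun beta => count_reduced_fractions resP (countC Q N beta ^~ N0)) c) LS.
have -> : \sum_(q <- gball Q | q != (0, 0)) \sum_(a <- res q | `[< gcoprime a q >])
    csqnorm (expsum N c q a) =
  \sum_(x <- reduced_fractions res Q) csqnorm (\sum_(n <- gball N)
     c n * ee (complex.Re (gC R n * fraction R x))).
  rewrite big_allpairs_dep big_filter; apply: eq_bigr => q _.
  rewrite big_filter; apply: eq_bigr => a _; congr csqnorm.
  by apply: eq_bigr => n _; rewrite /fraction mulrA.
apply: le_trans LS _; rewrite ler_wpM2r //.
  by apply: sumr_ge0 => n _; apply: csqnorm_ge0.
have NB : B * N%:R = Q%:R ^+ 3 + Q%:R ^+ 2 * Num.sqrt N%:R + N%:R.
  rewrite /B.
  have : N%:R = Num.sqrt N%:R ^+ 2 :> R by rewrite sqr_sqrtr // ltW.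
  move: (Num.sqrt N%:R) sp => t t0 ->.
  by field; rewrite gt_eqF.
have -> : 1350 * 1350 * K * N%:R = 1350 * 1350 * C * N%:R `^ eps * (B * N%:R).
  by rewrite /K; ring.
rewrite NB ler_wpM2r //.
  by rewrite -NB mulr_ge0 ?(ltW B0).
(* The count costs N^eps, which [Q >= 1] bounds by (QN)^eps. *)
rewrite ler_wpM2l ?mulr_ge0 ?(ltW C0) //; apply: ge0_ler_powR.
- exact: ltW.
- by rewrite nnegrE.
- by rewrite nnegrE mulr_ge0.
- by rewrite ler_peMl // ler1n.
Qed.
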